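(* There is an algorithm (an oracle Turing functional) which, given a name of a presentation $X^\#$ of a compact Polish space $X$ and a total boundedness function for $X^\#$, computes a name of the presentation of $C^*(X)$ induced by $X^\#$. Furthermore, given two names of the same presentation $X^\#$, the computed names refer to presentations of $C^*(X)$ that are computably isometrically isomorphic via the identity map.
   Context: For a compact Polish space $X$, $C^*(X)$ is the commutative unital $C^*$-algebra of continuous functions $X\to\mathbb{C}$ with the sup norm, pointwise operations and complex conjugation as involution; $\mathbf{1}$ its unit. For $p\in X$, $\vec{d}_p(q)=d(p,q)$. A presentation of a metric space $(M,d)$ is $M^\#=(M,(s_j))$ with $(s_j)$ dense; a presentation of $X$ is $X^\#=(X,d,(p_n))$ with $d$ a compatible metric. Its diagram is $\{(r,j,k,r'): r,r'\in\mathbb{Q},\ r<d(s_j,s_k)<r'\}$; a name of $M^\#$ is $f\in\mathbb{N}^\mathbb{N}$ whose range is exactly the set of codes $\langle r,j,k,r'\rangle$ of diagram elements. A total boundedness function of $M^\#$ is $f:\mathbb{N}\to\mathbb{N}$ such that $f(j)$ codes a finite $F\subseteq\mathbb{N}$ with $M=\bigcup_{k\in F}B(s_k;2^{-j})$. Fix an effective enumeration $(\mathfrak{p}_n)$ of the $*$-polynomials with coefficients in $\mathbb{Q}(i)$ in variables $x_0,x_1,\dots$. A presentation of a $C^*$-algebra $A$ is $A^\#=(A,(u_n))$ such that the rational vectors $\mathfrak{p}_n[A^\#]$ (substitute $u_j$ for $x_j$) are dense; its diagram is $\{(r,j,r'): r,r'\in\mathbb{Q}\cap(0,\infty),\ r<\|\mathfrak{p}_j[A^\#]\|<r'\}$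 and a name of $A^\#$ is $f\in\mathbb{N}^\mathbb{N}$ whose range is exactly the set of codes of diagram elements. Presentations are regarded as presented metric spaces with rational vectors as distinguished points; a map between them is computable if an oracle Turing machine transforms names $(m_k)$ (with $\|\mathfrak{p}_{m_k}-v\|<2^{-k}$) of inputs into names of outputs. The presentation induced by $X^\#$ is $(C^*(X),(f_n)_{n\in\mathbb{N}})$ with $f_0=\mathbf{1}$ and $f_{n+1}=\vec{d}_{p_n}$. *)

(* Defs.v *)
From HB Require Import structures.
From Stdlib Require Cantor.
From mathcomp Require Import all_boot all_order all_algebra.
From mathcomp Require Import complex lra.
From mathcomp Require Import all_classical all_reals all_analysis.

Set Implicit Arguments.
Unset Strict Implicit.
Unset Printing Implicit Defensive.

Import Order.TTheory GRing.Theory Num.Theory.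
Import numFieldNormedType.Exports.

Local Open Scope classical_set_scope.
Local Open Scope ring_scope.
Local Open Scope complex_scope.

(* Turing functionals are given as programs for Kleene's partial recursive
   functions relative to an oracle [O : nat -> nat]. Programs are unary and take
   several arguments through the Cantor pairing. *)
Notation npair a b := (Cantor.to_nat (a, b)).

Inductive functional : Type :=
| Zero | Succ | Fst | Snd
| Query
| Pair of functional & functional
| Comp of functional & functional
| Prec of functional & functional
| Mu of functional.

(* [Prec F G] is primitive recursion on the second component of its argument,
   and [Mu F] maps [a] to the least [n] with [F (a, n) = 0]; the sequence [w]
   witnesses that the earlier values are defined and nonzero. *)
Inductive eval (O : nat -> nat) : functional -> nat -> nat -> Prop :=
| EvalZero x : eval O Zero x 0%N
| EvalSucc x : eval O Succ x x.+1
| EvalFst a b : eval O Fst (npair a b) a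
| EvalSnd a b : eval O Snd (npair a b) b
| EvalQuery x : eval O Query x (O x)
| EvalPair F G x y z :
    eval O F x y -> eval O G x z -> eval O (Pair F G) x (npair y z)
| EvalComp F G x y z :
    eval O G x y -> eval O F y z -> eval O (Comp F G) x z
| EvalPrec0 F G a y :
    eval O F a y -> eval O (Prec F G) (npair a 0%N) y
| EvalPrecS F G a n y z :
    eval O (Prec F G) (npair a n) y ->
    eval O G (npair a (npair n y)) z ->
    eval O (Prec F G) (npair a n.+1) z
| EvalMu F a n (w : nat -> nat) :
    eval O F (npair a n) 0%N ->
    (forall k, (k < n)%N -> eval O F (npair a k) (w k).+1) ->
    eval O (Mu F) a n.

Definition computes (F : functional) (O h : nat -> nat) : Prop :=
  forall n, eval O F n (h n).

(* The join of two oracles, through which a functional of two arguments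
   accesses both of them. *)
Definition join (f g : nat -> nat) : nat -> nat :=
  fun n => if odd n then g n./2 else f n./2.

Definition int_code (z : int) : nat :=
  match z with Posz n => n.*2 | Negz n => n.*2.+1 end.

Definition int_decode (n : nat) : int :=
  if odd n then Negz n./2 else Posz n./2.

Lemma int_codeK : cancel int_code int_decode.
Proof.
rewrite /int_decode; case=> n /=; first by rewrite odd_double doubleK.
by rewrite odd_double /= uphalf_double.
Qed.

Definition rat_code (r : rat) : nat :=
  npair (int_code (numq r)) `|denq r|%N.-1.

Definition rat_decode (n : nat) : rat :=
  let: (a, b) := Cantor.of_nat n in (int_decode a)%:~R / b.+1%:R.

Lemma rat_codeK : cancel rat_code rat_decode.
Proof.
move=> r; rewrite /rat_decode /rat_code Cantor.cancel_of_to int_codeK.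
rewrite prednK ?absz_gt0 ?denq_neq0 // -[RHS]divq_num_den; congr (_ / _).
by rewrite natr_absz gtr0_norm ?denq_gt0.
Qed.

(* Finite lists, and hence finite sets of natural numbers, are coded by the
   bijection [CodeSeq.code : seq nat -> nat]. *)
Definition codes_finset (n : nat) : {pred nat} := mem (CodeSeq.decode n).

Definition enumerates (f : nat -> nat) (D : set nat) : Prop := range f = D.

Definition is_metric (R : realType) (T : Type) (d : T -> T -> R) : Prop :=
  [/\ forall x, d x x = 0,
      forall x y, d x y = 0 -> x = y,
      forall x y, d x y = d y x
    & forall x y z, d x z <= d x y + d y z].

Definition compatible (R : realType) (X : topologicalType) (d : X -> X -> R) :
    Prop :=
  forall x (A : set X),
    nbhs x A <-> exists2 e : R, 0 < e & [set y | d x y < e] `<=` A.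

Definition complete_metric (R : realType) (T : Type) (d : T -> T -> R) : Prop :=
  forall u : nat -> T,
    (forall e, 0 < e -> exists N, forall m n,
       (N <= m)%N -> (N <= n)%N -> d (u m) (u n) < e) ->
    exists l, forall e, 0 < e -> exists N, forall n,
      (N <= n)%N -> d (u n) l < e.

Definition polish (R : realType) (X : topologicalType) : Prop :=
  (exists D : set X, countable D /\ dense D) /\
  (exists d : X -> X -> R, [/\ is_metric d, compatible d & complete_metric d]).

(* Nonemptiness makes C*(X) a nontrivial ring; it holds as soon as [X] has a
   presentation, which includes a sequence of points. *)
Record compactPolish (R : realType) : Type := CompactPolish {
  cp_space :> topologicalType;
  cp_nonempty : [set: cp_space] !=set0;
  cp_compact : compact [set: cp_space];
  cp_polish : polish R cp_space }.

Record presentation (R : realType) (X : topologicalType) : Type :=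
  Presentation {
    pdist : X -> X -> R;
    ppoint : nat -> X;
    pdist_metric : is_metric pdist;
    pdist_compatible : compatible pdist;
    ppoint_dense : dense (range ppoint) }.

Definition diagram (R : realType) (X : topologicalType)
    (P : presentation R X) : set nat :=
  [set n | exists (r : rat) (j k : nat) (r' : rat),
     n = npair (rat_code r) (npair j (npair k (rat_code r'))) /\
     ratr r < pdist P (ppoint P j) (ppoint P k) < ratr r'].

Definition is_name (R : realType) (X : topologicalType)
    (P : presentation R X) (f : nat -> nat) : Prop :=
  enumerates f (diagram P).

Definition total_boundedness_function (R : realType) (X : topologicalType)
    (P : presentation R X) (g : nat -> nat) : Prop :=
  forall j, [set: X] =
    \bigcup_(k in [set k | k \in codes_finset (g j)])
      [set x | pdist P (ppoint P k) x < 2 ^- j].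

HB.mixin Record isCstarAlgebra (R : realType) A
    of GRing.Algebra R[i] A := {
  cstar : A -> A;
  cnorm : A -> R;
  cstarK : forall x : A, cstar (cstar x) = x;
  cstarD : forall x y : A, cstar (x + y) = cstar x + cstar y;
  cstarZ : forall (a : R[i]) (x : A), cstar (a *: x) = a^* *: cstar x;
  cstarM : forall x y : A, cstar (x * y) = cstar y * cstar x;
  cnorm0_eq0 : forall x : A, cnorm x = 0 -> x = 0;
  cnormZ : forall (a : R[i]) (x : A),
    cnorm (a *: x) = Normc.normc a * cnorm x;
  cnormD : forall x y : A, cnorm (x + y) <= cnorm x + cnorm y;
  cnormM : forall x y : A, cnorm (x * y) <= cnorm x * cnorm y;
  cnorm_cstar : forall x : A, cnorm (cstar x * x) = cnorm x ^+ 2;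
  cnorm_complete : complete_metric (fun x y : A => cnorm (x - y)) }.

#[short(type="cstarAlgType")]
HB.structure Definition CstarAlgebra (R : realType) :=
  { A of GRing.Algebra R[i] A & isCstarAlgebra R A }.

(* Variables do not commute. The monomial [((a, b), w)] has coefficient a + ib
   and word [w]; the letter [(j, false)] is x_j and [(j, true)] is x_j^*. A
   polynomial is a formal sum of monomials; constant terms (empty words) are
   allowed, as the algebras are unital. *)
Definition starmonomial : Type := (rat * rat) * seq (nat * bool).
Definition starpoly : Type := seq starmonomial.

Definition letter_decode (n : nat) : nat * bool := (n./2, odd n).

Definition starmonomial_decode (n : nat) : starmonomial :=
  let: (c, w) := Cantor.of_nat n in
  let: (a, b) := Cantor.of_nat c in
  ((rat_decode a, rat_decode b), map letter_decode (CodeSeq.decode w)).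

Definition starpoly_enum (n : nat) : starpoly :=
  map starmonomial_decode (CodeSeq.decode n).

Lemma starpoly_enum_surj (p : starpoly) : exists n, starpoly_enum n = p.
Proof.
pose lcode (l : nat * bool) : nat := (l.2 + l.1.*2)%N.
pose mcode (t : starmonomial) : nat :=
  npair (npair (rat_code t.1.1) (rat_code t.1.2))
        (CodeSeq.code (map lcode t.2)).
have lcodeK : cancel lcode letter_decode.
  case=> j b; rewrite /letter_decode /lcode /= half_bit_double.
  by rewrite oddD odd_double addbF oddb.
have mcodeK : cancel mcode starmonomial_decode.
  case=> [[a b] w]; rewrite /starmonomial_decode /mcode.
  by rewrite !Cantor.cancel_of_to CodeSeq.codeK !rat_codeK (mapK lcodeK).
exists (CodeSeq.code (map mcode p)).
by rewrite /starpoly_enum CodeSeq.codeK (mapK mcodeK).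
Qed.

Definition starpoly_eval (R : realType) (A : cstarAlgType R) (u : nat -> A)
    (p : starpoly) : A :=
  \sum_(t <- p) (ratr t.1.1 +i* ratr t.1.2 : R[i]) *:
    \prod_(l <- t.2) (if l.2 then cstar (u l.1) else u l.1).

Definition rational_vector (R : realType) (A : cstarAlgType R) (u : nat -> A)
    (n : nat) : A := starpoly_eval u (starpoly_enum n).

Definition is_cpresentation (R : realType) (A : cstarAlgType R)
    (u : nat -> A) : Prop :=
  forall (a : A) (e : R), 0 < e ->
    exists n, cnorm (rational_vector u n - a) < e.

Definition cdiagram (R : realType) (A : cstarAlgType R) (u : nat -> A) :
    set nat :=
  [set n | exists (r : rat) (j : nat) (r' : rat),
     [/\ n = npair (rat_code r) (npair j (rat_code r')),
         0 < r, 0 < r' & ratr r < cnorm (rational_vector u j) < ratr r']].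

Definition is_cname (R : realType) (A : cstarAlgType R) (u : nat -> A)
    (f : nat -> nat) : Prop := enumerates f (cdiagram u).

Definition is_vector_name (R : realType) (A : cstarAlgType R) (u : nat -> A)
    (a : A) (m : nat -> nat) : Prop :=
  forall k, cnorm (rational_vector u (m k) - a) < 2 ^- k.

Definition computable_map (R : realType) (A B : cstarAlgType R)
    (u : nat -> A) (v : nat -> B) (phi : A -> B) : Prop :=
  exists F : functional, forall (a : A) (m : nat -> nat),
    is_vector_name u a m ->
    exists m', computes F m m' /\ is_vector_name v (phi a) m'.

Definition isometric_isomorphism (R : realType) (A B : cstarAlgType R)
    (phi : A -> B) : Prop :=
  [/\ forall x y, phi (x + y) = phi x + phi y,
      forall (a : R[i]) x, phi (a *: x) = a *: phi x,
      phi 1 = 1 /\ (forall x y, phi (x * y) = phi x * phi y),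
      forall x, phi (cstar x) = cstar (phi x)
    & (forall x, cnorm (phi x) = cnorm x) /\ bijective phi].

Definition computably_isometrically_isomorphic_via (R : realType)
    (A B : cstarAlgType R) (u : nat -> A) (v : nat -> B) (phi : A -> B) :
    Prop :=
  [/\ isometric_isomorphism phi,
      computable_map u v phi
    & exists psi : B -> A,
        [/\ cancel phi psi, cancel psi phi & computable_map v u psi]].

Local Notation normc := Normc.normc.

Lemma normCE (R : rcfType) (z : R[i]) : `|z| = (normc z)%:C.
Proof. by case: z. Qed.

Lemma normc_ge0 (R : rcfType) (z : R[i]) : 0 <= normc z.
Proof. by case: z => a b; exact: sqrtr_ge0. Qed.

Lemma normcD_le (R : rcfType) (x y : R[i]) : normc (x + y) <= normc x + normc y.
Proof. exact: le_normcD. Qed.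

Lemma normcB (R : rcfType) (x y : R[i]) : normc (x - y) = normc (y - x).
Proof. by rewrite -(normcN (x - y)) opprB. Qed.

Lemma normcJ_eq (R : rcfType) (x : R[i]) : normc x^* = normc x.
Proof. by case: x => a b /=; rewrite sqrrN. Qed.

Lemma normcR (R : rcfType) (x : R) : normc x%:C = `|x|.
Proof. by rewrite /= expr0n addr0 sqrtr_sqr. Qed.

Lemma continuousC_P (R : realType) (X : topologicalType) (f : X -> R[i]^o) :
  continuous f <->
  (forall x (e : R), 0 < e -> \forall y \near x, normc (f x - f y) < e).
Proof.
split=> [fc x e e0|H x].
  have /cvgrPdist_lt /(_ e%:C) := fc x.
  rewrite ltcR => /(_ e0).
  by apply: filterS => y; rewrite normCE ltcR.
apply/cvgrPdist_lt => e; rewrite ltcE => /andP[/eqP /= Ie Re0].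
apply: filterS (H x _ Re0) => y.
by rewrite normCE -ltcR; case: e Ie {Re0} => a b /= ->.
Qed.

Definition Cfun (R : realType) (X : compactPolish R) : Type :=
  continuousType X R[i]^o.

Section CfunAlgebra.
Context (R : realType) (X : compactPolish R).
Implicit Types f g h : Cfun X.

HB.instance Definition _ := Choice.on (Cfun X).

Lemma cfunP f g : (forall x, f x = g x) -> f = g.
Proof. by move=> fg; apply/continuousEP. Qed.

Lemma cfun_cts f : continuous (f : X -> R[i]^o). Proof. exact: cts_fun. Qed.

Lemma cfun_add_cts f g : continuous (fun x : X => f x + g x : R[i]^o).
Proof. by move=> x; apply: cvgD; exact: cfun_cts. Qed.

Lemma cfun_opp_cts f : continuous (fun x : X => - f x : R[i]^o).
Proof. by move=> x; apply: cvgN; exact: cfun_cts. Qed.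

Lemma cfun_mul_cts f g : continuous (fun x : X => f x * g x : R[i]^o).
Proof. by move=> x; apply: cvgM; exact: cfun_cts. Qed.

Lemma cfun_scale_cts (a : R[i]) f : continuous (fun x : X => a * f x : R[i]^o).
Proof. by move=> x; apply: cvgM; [exact: cvg_cst|exact: cfun_cts]. Qed.

Lemma cfun_star_cts f : continuous (fun x : X => (f x)^* : R[i]^o).
Proof.
apply/continuousC_P => x e e0; have /continuousC_P/(_ x e e0) := @cfun_cts f.
by apply: filterS => y; rewrite -rmorphB normcJ_eq.
Qed.

Lemma cfun_const_cts (a : R[i]) : continuous (fun _ : X => a : R[i]^o).
Proof. by move=> x; exact: cvg_cst. Qed.

Definition cfun_add f g : Cfun X := mkcts (@cfun_add_cts f g).
Definition cfun_opp f : Cfun X := mkcts (@cfun_opp_cts f).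
Definition cfun_mul f g : Cfun X := mkcts (@cfun_mul_cts f g).
Definition cfun_scale (a : R[i]) f : Cfun X := mkcts (@cfun_scale_cts a f).
Definition cfun_star f : Cfun X := mkcts (@cfun_star_cts f).
Definition cfun_const (a : R[i]) : Cfun X := mkcts (@cfun_const_cts a).

Definition cfun_norm f : R := sup (range (fun x : X => normc (f x))).

Fact cfun_addA : associative cfun_add.
Proof. by move=> f g h; apply: cfunP => x; exact: addrA. Qed.
Fact cfun_addC : commutative cfun_add.
Proof. by move=> f g; apply: cfunP => x; exact: addrC. Qed.
Fact cfun_add0 : left_id (cfun_const 0) cfun_add.
Proof. by move=> f; apply: cfunP => x; exact: add0r. Qed.
Fact cfun_addN : left_inverse (cfun_const 0) cfun_opp cfun_add.
Proof. by move=> f; apply: cfunP => x; exact: addNr. Qed.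

HB.instance Definition _ :=
  GRing.isZmodule.Build (Cfun X) cfun_addA cfun_addC cfun_add0 cfun_addN.

Fact cfun_mulA : associative cfun_mul.
Proof. by move=> f g h; apply: cfunP => x; exact: mulrA. Qed.
Fact cfun_mulC : commutative cfun_mul.
Proof. by move=> f g; apply: cfunP => x; exact: mulrC. Qed.
Fact cfun_mul1 : left_id (cfun_const 1) cfun_mul.
Proof. by move=> f; apply: cfunP => x; exact: mul1r. Qed.
Fact cfun_mulD : left_distributive cfun_mul +%R.
Proof. by move=> f g h; apply: cfunP => x; exact: mulrDl. Qed.
Fact cfun_1neq0 : cfun_const 1 != 0.
Proof.
have [x _] := @cp_nonempty R X.
by apply/eqP => /(congr1 (fun f : Cfun X => f x)) /eqP; rewrite oner_eq0.
Qed.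

HB.instance Definition _ := GRing.Zmodule_isComNzRing.Build (Cfun X)
  cfun_mulA cfun_mulC cfun_mul1 cfun_mulD cfun_1neq0.

Fact cfun_scaleA (a b : R[i]) f :
  cfun_scale a (cfun_scale b f) = cfun_scale (a * b) f.
Proof. by apply: cfunP => x; exact: mulrA. Qed.
Fact cfun_scale1 : left_id 1 cfun_scale.
Proof. by move=> f; apply: cfunP => x; exact: mul1r. Qed.
Fact cfun_scaleDr : right_distributive cfun_scale +%R.
Proof. by move=> a f g; apply: cfunP => x; exact: mulrDr. Qed.
Fact cfun_scaleDl f : {morph cfun_scale^~ f : a b / a + b}.
Proof. by move=> a b; apply: cfunP => x; exact: mulrDl. Qed.

HB.instance Definition _ := GRing.Zmodule_isLmodule.Build R[i] (Cfun X)
  cfun_scaleA cfun_scale1 cfun_scaleDr cfun_scaleDl.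

Fact cfun_scaleAl (a : R[i]) f g : a *: (f * g) = (a *: f) * g.
Proof. by apply: cfunP => x; exact: mulrA. Qed.

HB.instance Definition _ :=
  GRing.Lmodule_isLalgebra.Build R[i] (Cfun X) cfun_scaleAl.

Fact cfun_scaleAr (a : R[i]) f g : a *: (f * g) = f * (a *: g).
Proof. by apply: cfunP => x; exact: mulrCA. Qed.

HB.instance Definition _ :=
  GRing.Lalgebra_isAlgebra.Build R[i] (Cfun X) cfun_scaleAr.

Lemma cfun_range_neq0 f : range (fun x : X => normc (f x)) !=set0.
Proof. by have [x _] := @cp_nonempty R X; exists (normc (f x)), x. Qed.

Lemma cfun_norm_cts f : continuous (fun x : X => normc (f x) : R).
Proof.
move=> x; apply/cvgrPdist_lt => e e0.
have /continuousC_P/(_ x e e0) := @cfun_cts f.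
apply: filterS => y; apply: le_lt_trans; rewrite ler_norml; apply/andP; split.
  by rewrite lerNl opprB lerBlDr normcB (le_trans _ (normcD_le _ _)) // subrK.
by rewrite lerBlDr (le_trans _ (normcD_le _ _)) // subrK.
Qed.

Lemma cfun_has_sup f : has_sup (range (fun x : X => normc (f x))).
Proof.
split; first exact: cfun_range_neq0.
have := continuous_compact (continuous_subspaceT (@cfun_norm_cts f))
  (@cp_compact R X).
move=> /compact_bounded [M [_ /(_ (M + 1))]].
rewrite ltrDl ltr01 => /(_ isT) MB; exists (M + 1) => _ [x _ <-].
by apply: le_trans (MB _ _); [exact: ler_norm|exists x].
Qed.

Lemma cfun_norm_ub f x : normc (f x) <= cfun_norm f.
Proof. by apply: (ub_le_sup (cfun_has_sup f).2); exists x. Qed.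

Lemma cfun_norm_le f (c : R) :
  (forall x, normc (f x) <= c) -> cfun_norm f <= c.
Proof.
by move=> H; apply: ge_sup; [exact: cfun_range_neq0|move=> _ [x _ <-]].
Qed.

Lemma cfun_norm_ge0 f : 0 <= cfun_norm f.
Proof.
have [x _] := @cp_nonempty R X.
exact: le_trans (normc_ge0 _) (cfun_norm_ub f x).
Qed.

Fact cfun_starK f : cfun_star (cfun_star f) = f.
Proof. by apply: cfunP => x; exact: conjcK. Qed.
Fact cfun_starD f g : cfun_star (f + g) = cfun_star f + cfun_star g.
Proof. by apply: cfunP => x; exact: rmorphD. Qed.
Fact cfun_starZ (a : R[i]) f : cfun_star (a *: f) = a^* *: cfun_star f.
Proof. by apply: cfunP => x; exact: rmorphM. Qed.
Fact cfun_starM f g : cfun_star (f * g) = cfun_star g * cfun_star f.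
Proof. by rewrite [RHS]mulrC; apply: cfunP => x; exact: rmorphM. Qed.

Fact cfun_norm0_eq0 f : cfun_norm f = 0 -> f = 0.
Proof.
move=> f0; apply: cfunP => x; apply: Normc.eq0_normc.
by apply/eqP; rewrite eq_le normc_ge0 andbT -f0 cfun_norm_ub.
Qed.

Fact cfun_normD f g : cfun_norm (f + g) <= cfun_norm f + cfun_norm g.
Proof.
apply: cfun_norm_le => x; apply: le_trans (normcD_le _ _) _.
by rewrite lerD ?cfun_norm_ub.
Qed.

Fact cfun_normM f g : cfun_norm (f * g) <= cfun_norm f * cfun_norm g.
Proof.
apply: cfun_norm_le => x; rewrite Normc.normcM.
by rewrite ler_pM ?normc_ge0 ?cfun_norm_ub.
Qed.

Lemma cfun_normZ_le (a : R[i]) f : cfun_norm (a *: f) <= normc a * cfun_norm f.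
Proof.
apply: cfun_norm_le => x; rewrite Normc.normcM.
by rewrite ler_wpM2l ?normc_ge0 ?cfun_norm_ub.
Qed.

Fact cfun_normZ (a : R[i]) f : cfun_norm (a *: f) = normc a * cfun_norm f.
Proof.
apply/eqP; rewrite eq_le cfun_normZ_le /=.
have [->|a0] := eqVneq a 0; first by rewrite Normc.normc0 mul0r cfun_norm_ge0.
have na0 : 0 < normc a.
  rewrite lt_neqAle normc_ge0 andbT eq_sym; apply: contra_neq a0.
  exact: Normc.eq0_normc.
rewrite mulrC -ler_pdivlMr // mulrC -Normc.normcV.
by apply: le_trans (cfun_normZ_le _ _); rewrite scalerA mulVf ?scale1r.
Qed.

Fact cfun_norm_star f : cfun_norm (cfun_star f * f) = cfun_norm f ^+ 2.
Proof.
apply/eqP; rewrite eq_le expr2; apply/andP; split.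
  apply: le_trans (cfun_normM _ _) _; rewrite ler_wpM2r ?cfun_norm_ge0 //.
  by apply: cfun_norm_le => x; rewrite normcJ_eq cfun_norm_ub.
rewrite -expr2 -(sqr_sqrtr (cfun_norm_ge0 (cfun_star f * f))).
rewrite ler_sqr ?nnegrE ?cfun_norm_ge0 ?sqrtr_ge0 //.
apply: cfun_norm_le => x.
rewrite -(ger0_norm (normc_ge0 (f x))) -sqrtr_sqr ler_wsqrtr //.
apply: le_trans (cfun_norm_ub _ x).
by rewrite Normc.normcM normcJ_eq expr2.
Qed.

Lemma Re_le_normc (z : R[i]) : `|complex.Re z| <= normc z.
Proof. by rewrite -lecR -normCE normc_ge_Re. Qed.

Lemma Im_le_normc (z : R[i]) : `|complex.Im z| <= normc z.
Proof.
by case: z => a b /=; rewrite -sqrtr_sqr ler_wsqrtr // lerDr sqr_ge0.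
Qed.

Lemma normc_le_ReIm (z : R[i]) :
  normc z <= `|complex.Re z| + `|complex.Im z|.
Proof.
case: z => a b /=.
rewrite -[leRHS]ger0_norm ?addr_ge0 // -sqrtr_sqr ler_wsqrtr //.
rewrite sqrrD !real_normK ?num_real // lerD2r lerDl.
by rewrite mulrn_wge0 // mulr_ge0.
Qed.

Fact cfun_complete : complete_metric (fun f g => cfun_norm (f - g)).
Proof.
move=> u uC.
have pw (x : X) e : 0 < e -> exists N, forall m n, (N <= m)%N -> (N <= n)%N ->
    normc (u m x - u n x) < e.
  move=> /uC [N HN]; exists N => m n Nm Nn.
  exact: le_lt_trans (cfun_norm_ub (u m - u n) x) (HN m n Nm Nn).
have cv (p : R[i] -> R) : (forall z w, p (z - w) = p z - p w) ->
    (forall z, `|p z| <= normc z) ->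
    forall x : X, exists l, forall e, 0 < e -> exists N, forall n, (N <= n)%N ->
      `|p (u n x) - l| < e.
  move=> pB pn x.
  have pc : cvgn (fun n => p (u n x)).
    apply/cauchy_cvgP/cauchyP => e e0.
    have [N HN] := pw x e e0; exists (p (u N x)); exists N => // n Nn /=.
    by rewrite /ball /= -pB (le_lt_trans (pn _)) // HN //=.
  exists (limn (fun n => p (u n x))) => e e0.
  have /cvgrPdist_lt/(_ e e0) [N _ HN] := pc.
  by exists N => n Nn; rewrite distrC; exact: HN.
have [lr Hlr] := choice (cv _ (fun z w => raddfB (@complex.Re R) z w)
  Re_le_normc).
have [li Hli] := choice (cv _ (fun z w => raddfB (@complex.Im R) z w)
  Im_le_normc).
pose l x : R[i] := lr x +i* li x.
have ul x e : 0 < e ->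
    exists N, forall n, (N <= n)%N -> normc (u n x - l x) < e.
  move=> e0; have e20 : 0 < e / 2 by rewrite divr_gt0.
  have [N1 H1] := Hlr x _ e20; have [N2 H2] := Hli x _ e20.
  exists (maxn N1 N2) => n; rewrite geq_max => /andP[n1 n2].
  apply: le_lt_trans (normc_le_ReIm _) _; rewrite [ltRHS]splitr.
  by rewrite !raddfB ltrD ?H1 ?H2.
have unif e : 0 < e ->
    exists N, forall n x, (N <= n)%N -> normc (u n x - l x) <= e.
  move=> e0; have e20 : 0 < e / 2 by rewrite divr_gt0.
  have [N HN] := uC _ e20; exists N => n x Nn.
  have [M HM] := ul x _ e20.
  rewrite -(subrKA (u (maxn N M) x)) [leRHS]splitr.
  apply: le_trans (normcD_le _ _) _; apply: lerD; last first.
    by rewrite ltW // HM // leq_maxr.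
  apply: le_trans (cfun_norm_ub (u n - u (maxn N M)) x) _.
  by rewrite ltW // HN // leq_maxl.
have lcts : continuous (l : X -> R[i]^o).
  apply/continuousC_P => x e e0; have e40 : 0 < e / 4 by rewrite divr_gt0.
  have [N HN] := unif _ e40.
  have /continuousC_P/(_ x _ e40) := @cfun_cts (u N).
  apply: filterS => y uxy.
  have lxy : l x - l y = (l x - u N x) + (u N x - u N y) + (u N y - l y).
    by rewrite [in RHS]subrKA subrKA.
  have A := HN N x (leqnn N); have B := HN N y (leqnn N).
  have C := normcD_le (l x - u N x + (u N x - u N y)) (u N y - l y).
  have D := normcD_le (l x - u N x) (u N x - u N y).
  rewrite normcB in A; rewrite lxy; lra.
exists (mkcts lcts) => e e0; have e20 : 0 < e / 2 by rewrite divr_gt0.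
have [N HN] := unif _ e20; exists N => n Nn.
apply: le_lt_trans (_ : e / 2 < e); last lra.
by apply: cfun_norm_le => x; exact: HN.
Qed.

HB.instance Definition _ := isCstarAlgebra.Build R (Cfun X)
  cfun_starK cfun_starD cfun_starZ cfun_starM
  cfun_norm0_eq0 cfun_normZ cfun_normD cfun_normM cfun_norm_star cfun_complete.

End CfunAlgebra.

Section Induced.
Context (R : realType) (X : compactPolish R) (P : presentation R X).

Lemma pdist_cts (p : X) : continuous (fun q : X => (pdist P p q)%:C : R[i]^o).
Proof.
have [_ _ dC dD] := pdist_metric P.
apply/continuousC_P => x e e0; apply/(pdist_compatible P); exists e => // y.
rewrite /mkset => dxy; have h : `|pdist P p x - pdist P p y| < e.
  have := dD p y x; have := dD p x y; have := dC x y.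
  by move=> *; rewrite ltr_norml; apply/andP; split; lra.
by rewrite -normcR rmorphB in h.
Qed.

Definition dist_fun (p : X) : Cfun X := mkcts (@pdist_cts p).

Definition induced_presentation (n : nat) : Cfun X :=
  if n is m.+1 then dist_fun (ppoint P m) else 1.

End Induced.

(* Main.v *)
(* Every vector of [C*(X)] named by a rational *-polynomial is a polynomial [q]
   in the functions [d(p_i, .)], so rational approximations to the numbers
   [d(p_i, p_k)] give a center and a radius of a disc containing [q(B(p_k; e))],
   and the radius tends to 0 with [e], uniformly in [k]. Hence [r < ||q||] is
   witnessed by one such disc, since [(p_k)] is dense, and [||q|| < r'] by the
   discs around a finite [e]-net, which the total boundedness function supplies;
   the names of [C*(X)] enumerate these witnesses.

   The rational vectors are dense by the argument of Stone and Weierstrass: the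
   uniform limits of rational vectors are closed under absolute values, hence
   under minima, and McShane's formula writes a continuous function on a finite
   net as a minimum of affine functions of distances, up to a small error. *)
Require Import Defs.
From Stdlib Require Cantor.
From mathcomp Require Import all_boot all_order all_algebra.
From mathcomp Require Import complex ring lra.
From mathcomp Require Import all_classical all_reals all_analysis.

Set Implicit Arguments.
Unset Strict Implicit.
Unset Printing Implicit Defensive.

Import Order.TTheory GRing.Theory Num.Theory.

(** * Computable functions relative to an oracle *)

#[local] Arguments Cantor.to_nat : simpl never.

Definition pi1 (n : nat) : nat := (Cantor.of_nat n).1.
Definition pi2 (n : nat) : nat := (Cantor.of_nat n).2.

Lemma pi1_pair a b : pi1 (npair a b) = a.
Proof. by rewrite /pi1 Cantor.cancel_of_to. Qed.

Lemma pi2_pair a b : pi2 (npair a b) = b.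
Proof. by rewrite /pi2 Cantor.cancel_of_to. Qed.

Lemma pair_pi n : npair (pi1 n) (pi2 n) = n.
Proof. by rewrite -[RHS]Cantor.cancel_to_of /pi1 /pi2; case: Cantor.of_nat. Qed.

Definition npairE := (pi1_pair, pi2_pair).

(** The indices [npair a b] of [eval] are not constructor patterns, so inversion is stated once for
    each program, with the pairs replaced by the projections [pi1] and [pi2]. *)
Lemma eval_inv (O : nat -> nat) F x y : Defs.eval O F x y ->
  match F with
  | Zero => y = 0%N
  | Succ => y = x.+1
  | Fst => y = pi1 x
  | Snd => y = pi2 x
  | Query => y = O x
  | Pair F G => exists a b,
      [/\ Defs.eval O F x a, Defs.eval O G x b & y = npair a b]
  | Comp F G => exists2 a, Defs.eval O G x a & Defs.eval O F a y
  | Prec F G =>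
      if pi2 x is n.+1 then
        exists2 z, Defs.eval O (Prec F G) (npair (pi1 x) n) z &
          Defs.eval O G (npair (pi1 x) (npair n z)) y
      else Defs.eval O F (pi1 x) y
  | Mu F => Defs.eval O F (npair x y) 0 /\
      forall k, (k < y)%N -> exists v, Defs.eval O F (npair x k) v.+1
  end.
Proof.
case=> {F x y}.
- by [].
- by [].
- by move=> a b; rewrite npairE.
- by move=> a b; rewrite npairE.
- by [].
- by move=> F G x y z Fy Gz; exists y, z.
- by move=> F G x y z Gy Fz; exists y.
- by move=> F G a y Fy; rewrite !npairE.
- by move=> F G a n y z Py Gz; rewrite !npairE; exists y.
- by move=> F a n w F0 FS; split=> // k kn; exists (w k); exact: FS.
Qed.

(** Induction on the first evaluation. In the [Mu] case, if the two results differed, the body would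
    take both the value 0 and a successor at the smaller one. *)
Lemma eval_fun (O : nat -> nat) F x y z :
  Defs.eval O F x y -> Defs.eval O F x z -> y = z.
Proof.
move=> ev; elim: ev z => {F x y}.
- by move=> x z /eval_inv.
- by move=> x z /eval_inv.
- by move=> a b z /eval_inv; rewrite npairE.
- by move=> a b z /eval_inv; rewrite npairE.
- by move=> x z /eval_inv.
- by move=> F G x y z _ IHF _ IHG w /eval_inv[a [b [/IHF-> /IHG-> ->]]].
- by move=> F G x y z _ IHG _ IHF w /eval_inv[a /IHG<- /IHF].
- by move=> F G a y _ IHF z /eval_inv; rewrite !npairE => /IHF.
- by move=> F G a n y z _ IHP _ IHG w /eval_inv; rewrite !npairE => -[b /IHP<- /IHG].
- move=> F a n w _ IH0 _ IHS z /eval_inv[z0 zS].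
  case: (ltngtP n z) => // lt; first by have [v /IH0] := zS _ lt.
  by have := IHS _ lt _ z0.
Qed.

(** One program has to serve all oracles satisfying [V]; this predicate is where the termination of
    unbounded searches is recorded. *)
Definition computable (V : (nat -> nat) -> Prop)
    (f : (nat -> nat) -> nat -> nat) : Prop :=
  exists F : functional, forall O, V O -> computes F O (f O).

Section Computable.
Variable V : (nat -> nat) -> Prop.
Local Notation C := (computable V).
Implicit Types (f g h : (nat -> nat) -> nat -> nat).
Implicit Types (b c : (nat -> nat) -> nat -> bool).

Lemma computable_ext f g : (forall O x, f O x = g O x) -> C f -> C g.
Proof. by move=> fg [F HF]; exists F => O VO x; rewrite -fg; exact: HF. Qed.

Lemma computable_id : C (fun _ x => x).
Proof.
exists (Pair Fst Snd) => O _ n; rewrite -(pair_pi n).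
by apply: EvalPair; [exact: EvalFst|exact: EvalSnd].
Qed.

Lemma computable_comp f g : C f -> C g -> C (fun O x => f O (g O x)).
Proof.
move=> [F HF] [G HG]; exists (Comp F G) => O VO n.
by apply: EvalComp; [exact: HG|exact: HF].
Qed.

Lemma computable_query f : C f -> C (fun O x => O (f O x)).
Proof.
by apply: (@computable_comp (fun O => O)); exists Query => O _ n; exact: EvalQuery.
Qed.

Lemma computable_pi1 f : C f -> C (fun O x => pi1 (f O x)).
Proof.
apply: (@computable_comp (fun _ => pi1)); exists Fst => O _ n.
by rewrite -{1}(pair_pi n); exact: EvalFst.
Qed.

Lemma computable_pi2 f : C f -> C (fun O x => pi2 (f O x)).
Proof.
apply: (@computable_comp (fun _ => pi2)); exists Snd => O _ n.
by rewrite -{1}(pair_pi n); exact: EvalSnd.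
Qed.

Lemma computable_succ f : C f -> C (fun O x => (f O x).+1).
Proof.
by apply: (@computable_comp (fun _ => S)); exists Succ => O _ n; exact: EvalSucc.
Qed.

Lemma computable_const n : C (fun _ _ => n).
Proof.
elim: n => [|n IHn]; first by exists Zero => O _ n; exact: EvalZero.
exact: computable_succ IHn.
Qed.

Lemma computable_pair f g : C f -> C g -> C (fun O x => npair (f O x) (g O x)).
Proof.
move=> [F HF] [G HG]; exists (Pair F G) => O VO n.
by apply: EvalPair; [exact: HF|exact: HG].
Qed.

(** The whole input [x] serves as the parameter of [Prec], so the step reads the triple of [x], the
    index and the accumulator. *)
Lemma computable_iteri f g (s : (nat -> nat) -> nat -> nat -> nat -> nat) :
  C f -> C (fun O z => s O (pi1 z) (pi1 (pi2 z)) (pi2 (pi2 z))) -> C g ->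
  C (fun O x => iteri (f O x) (s O x) (g O x)).
Proof.
move=> Cf [S HS] [G HG].
pose r O z := iteri (pi2 z) (s O (pi1 z)) (g O (pi1 z)).
have Cr : C r.
  exists (Prec G S) => O VO n; rewrite -{1}(pair_pi n) /r.
  elim: (pi2 n) => [|m IHm]; first by apply: EvalPrec0; exact: HG.
  apply: (EvalPrecS IHm).
  by have := HS O VO (npair (pi1 n) (npair m (iteri m (s O (pi1 n)) (g O (pi1 n)))));
     rewrite !npairE.
apply: computable_ext (computable_comp Cr (computable_pair computable_id Cf)).
by move=> O x; rewrite /r !npairE.
Qed.

Lemma computable_iter f g (s : (nat -> nat) -> nat -> nat -> nat) :
  C f -> C (fun O z => s O (pi1 z) (pi2 z)) -> C g ->
  C (fun O x => iter (f O x) (s O x) (g O x)).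
Proof.
move=> Cf Cs Cg.
have Cs' : C (fun O z => s O (pi1 z) (pi2 (pi2 z))).
  have Cp := computable_pair (computable_pi1 computable_id)
    (computable_pi2 (computable_pi2 computable_id)).
  by apply: computable_ext (computable_comp Cs Cp) => O x; rewrite !npairE.
apply: computable_ext (computable_iteri (s := fun O x _ => s O x) Cf Cs' Cg).
by move=> O x; elim: (f O x) => //= n ->.
Qed.

Lemma computable_add f g : C f -> C g -> C (fun O x => (f O x + g O x)%N).
Proof.
move=> Cf Cg.
apply: computable_ext (computable_iter (s := fun _ _ => S) Cf _ Cg).
  by move=> O x; rewrite iter_succn addnC.
exact/computable_succ/computable_pi2/computable_id.
Qed.

Lemma computable_mul f g : C f -> C g -> C (fun O x => (f O x * g O x)%N).
Proof.
move=> Cf Cg.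
apply: computable_ext
  (computable_iter (s := fun O x m => (g O x + m)%N) Cf _ (computable_const 0)).
  by move=> O x; rewrite iter_addn_0 mulnC.
apply: computable_add; last exact/computable_pi2/computable_id.
exact/computable_comp/computable_pi1/computable_id.
Qed.

Lemma computable_pred f : C f -> C (fun O x => (f O x).-1).
Proof.
move=> Cf.
apply: computable_ext
  (computable_iteri (s := fun _ _ i _ => i) Cf _ (computable_const 0)).
  by move=> O x; case: (f O x).
exact/computable_pi1/computable_pi2/computable_id.
Qed.

Lemma computable_sub f g : C f -> C g -> C (fun O x => (f O x - g O x)%N).
Proof.
move=> Cf Cg.
apply: computable_ext (computable_iter (s := fun _ _ => predn) Cg _ Cf).
  by move=> O x; rewrite iter_predn.
exact/computable_pred/computable_pi2/computable_id.
Qed.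

Lemma computable_eq0 f : C f -> C (fun O x => f O x == 0%N).
Proof.
move=> Cf.
apply: computable_ext (computable_sub (computable_const 1) Cf) => O x.
by case: (f O x) => [|n] //=; rewrite subSS sub0n.
Qed.

Lemma computable_if b f g : C b -> C f -> C g ->
  C (fun O x => if b O x then f O x else g O x).
Proof.
move=> Cb Cf Cg.
apply: computable_ext
  (computable_iter (s := fun O x _ => f O x) Cb _ Cg).
  by move=> O x; case: (b O x).
exact/computable_comp/computable_pi1/computable_id.
Qed.

Lemma computable_neg b : C b -> C (fun O x => ~~ b O x).
Proof.
move=> Cb; apply: computable_ext (computable_eq0 Cb) => O x.
by case: (b O x).
Qed.

Lemma computable_and b c : C b -> C c -> C (fun O x => b O x && c O x).
Proof.
move=> Cb Cc; apply: computable_ext (computable_mul Cb Cc) => O x.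
by rewrite mulnb.
Qed.

Lemma computable_leq f g : C f -> C g -> C (fun O x => (f O x <= g O x)%N).
Proof. by move=> Cf Cg; exact: (computable_eq0 (computable_sub Cf Cg)). Qed.

Lemma computable_eq f g : C f -> C g -> C (fun O x => f O x == g O x).
Proof.
move=> Cf Cg; have := computable_and (computable_leq Cf Cg) (computable_leq Cg Cf).
by apply: computable_ext => O x; rewrite eqn_leq.
Qed.

Lemma computable_double f : C f -> C (fun O x => (f O x).*2).
Proof.
move=> Cf; apply: computable_ext (computable_add Cf Cf) => O x.
exact: addnn.
Qed.

Lemma computable_odd f : C f -> C (fun O x => odd (f O x)).
Proof.
move=> Cf.
apply: computable_ext
  (computable_iter (s := fun _ _ m => m == 0%N :> nat) Cf _ (computable_const 0)).
  by move=> O x; elim: (f O x) => //= n ->; case: (odd n).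
exact/computable_eq0/computable_pi2/computable_id.
Qed.

Lemma computable_half f : C f -> C (fun O x => (f O x)./2).
Proof.
move=> Cf.
(* [n./2] is the number of odd indices below [n]. *)
apply: computable_ext
  (computable_iteri (s := fun _ _ i m => (m + odd i)%N) Cf _ (computable_const 0)).
  by move=> O x; elim: (f O x) => //= n ->; rewrite uphalf_half addnC.
apply: computable_add; first exact/computable_pi2/computable_pi2/computable_id.
exact/computable_odd/computable_pi1/computable_pi2/computable_id.
Qed.

(** The default 0 makes the function total in the logic; [computable_least] applies only where a
    witness exists. *)
Definition least (p : nat -> bool) : nat :=
  if pselect (exists n, p n) is left ex then ex_minn ex else 0%N.

Lemma leastP (p : nat -> bool) : (exists n, p n) -> p (least p).
Proof. by rewrite /least => ex; case: pselect => // e; case: ex_minnP. Qed.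

Lemma computable_least (p : (nat -> nat) -> nat -> nat -> bool) :
  (forall O, V O -> forall x, exists n, p O x n) ->
  C (fun O z => p O (pi1 z) (pi2 z)) -> C (fun O x => least (p O x)).
Proof.
move=> ex /computable_neg [F HF]; exists (Mu F) => O VO x.
rewrite /least; case: pselect => [e|/(_ (ex O VO x))//].
(* [Mu] looks for a zero, hence the negated test. Before the minimum the negation is [true], that is
   1, so the predecessors [w] are constantly 0. *)
case: ex_minnP => n pn nmin; apply: (@EvalMu O F x n (fun=> 0)).
  by have := HF O VO (npair x n); rewrite !npairE pn.
move=> k kn; have := HF O VO (npair x k); rewrite !npairE.
by case pk: (p O x k) => //; have := nmin _ pk; rewrite leqNgt kn.
Qed.

(** [CodeSeq.decode_rec] recurses on its fuel [q] while changing the pending letter [v] and the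
    counter [r]. This is one such step on the state [(acc, (v, r))], except that a finished letter
    is fed to [s] at once instead of being put on a list. *)
Definition foldl_state (s : nat -> nat -> nat) (q z : nat) : nat :=
  let acc := pi1 z in let v := pi1 (pi2 z) in let r := pi2 (pi2 z) in
  if r == 0 then npair (s acc v) (npair 0 q)
  else if r.-1 == 0 then npair acc (npair v.+1 q)
  else npair acc (npair v r.-2).

Definition foldl_rest (s : nat -> nat -> nat) (q z : nat) : nat :=
  foldl s (pi1 z) (CodeSeq.decode_rec (pi1 (pi2 z)) q (pi2 (pi2 z))).

Lemma foldl_stateE s q z : foldl_rest s q (foldl_state s q z) = foldl_rest s q.+1 z.
Proof.
by rewrite /foldl_rest /foldl_state; case: (pi2 (pi2 z)) => [|[|r]] /=; rewrite !npairE.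
Qed.

(** The invariant is [foldl_rest], the fold over what is still to be decoded, while the fuel drops
    from [n.-1] to 0. With no fuel left the decoder returns the pending letter, whence the last
    application of [s]. *)
Lemma foldl_decode s acc n :
  foldl s acc (CodeSeq.decode n) =
  if n == 0%N then acc else
  let z := iteri n.-1 (fun i => foldl_state s (n.-1 - i.+1))
             (npair acc (npair 0 n.-1)) in
  s (pi1 z) (pi1 (pi2 z)).
Proof.
case: n => [//|q]; rewrite [_ == _]/= [q.+1.-1]/= /CodeSeq.decode.
set z0 := npair _ _; transitivity (foldl_rest s q z0); first by rewrite /foldl_rest !npairE.
set st := fun i : nat => foldl_state s (q - i.+1); suff H k : (k <= q)%N ->
    foldl_rest s q z0 = foldl_rest s (q - k) (iteri k st z0).
  by rewrite (H q) // subnn /foldl_rest.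
elim: k => [|k IHk] kq /=; first by rewrite subn0.
by rewrite IHk ?(ltnW kq) // /st foldl_stateE subnSK.
Qed.

Lemma computable_foldl f g (s : (nat -> nat) -> nat -> nat -> nat -> nat) :
  C (fun O z => s O (pi1 z) (pi1 (pi2 z)) (pi2 (pi2 z))) -> C g -> C f ->
  C (fun O x => foldl (s O x) (g O x) (CodeSeq.decode (f O x))).
Proof.
move=> Cs Cg Cf.
have Cs' p q r : C p -> C q -> C r -> C (fun O x => s O (p O x) (q O x) (r O x)).
  move=> Ca Cb Cc; have Cp := computable_pair Ca (computable_pair Cb Cc).
  by apply: computable_ext (computable_comp Cs Cp) => O x; rewrite !npairE.
pose z O x := iteri (f O x).-1
  (fun i => foldl_state (s O x) ((f O x).-1 - i.+1))
  (npair (g O x) (npair 0 (f O x).-1)).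
apply: (@computable_ext (fun O x => if f O x == 0 then g O x else
    s O x (pi1 (z O x)) (pi1 (pi2 (z O x))))) => [? ?|].
  by rewrite foldl_decode.
have C1 := computable_pi1 computable_id.
have C21 := computable_pi1 (computable_pi2 computable_id).
have C22 := computable_pi2 (computable_pi2 computable_id).
apply: computable_if; [exact: computable_eq0|exact: Cg|].
have Cz : C z.
  apply: (computable_iteri
    (s := fun O x i => foldl_state (s O x) ((f O x).-1 - i.+1))).
  - exact: computable_pred.
  - have Cq : C (fun O z => ((f O (pi1 z)).-1 - (pi1 (pi2 z)).+1)%N).
      apply: computable_sub; last exact: computable_succ.
      exact/computable_pred/computable_comp.
    cbv beta zeta delta [foldl_state]; apply: computable_if.
    + exact/computable_eq0/computable_pi2/computable_pi2.
    + apply: computable_pair; last first.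
        by apply: computable_pair => //; exact: computable_const.
      apply: Cs' => //; first exact: computable_pi1.
      exact/computable_pi1/computable_pi2.
    + apply: computable_if.
      * exact/computable_eq0/computable_pred/computable_pi2/computable_pi2.
      * apply: computable_pair; first exact: computable_pi1.
        apply: computable_pair => //.
        exact/computable_succ/computable_pi1/computable_pi2.
      * apply: computable_pair; first exact: computable_pi1.
        apply: computable_pair; first exact/computable_pi1/computable_pi2.
        exact/computable_pred/computable_pred/computable_pi2/computable_pi2.
  - apply: computable_pair => //; apply: computable_pair; first exact: computable_const.
    exact: computable_pred.
apply: Cs'; first exact: computable_id.
  exact: computable_pi1.
exact/computable_pi1/computable_pi2.
Qed.

End Computable.

(** * The search for witnesses *)

Ltac computability :=
  cbv beta;
  repeat match goal with
  | |- computable _ (fun=> id) => exact: computable_id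
  | |- computable _ (fun _ _ => _) => exact: computable_const
  | H : computable _ ?f |- computable _ ?f => exact: H
  | H : computable _ ?f |- computable _ (fun O z => ?f O _) =>
      apply: (computable_comp H)
  | |- _ => first [ simple apply computable_pi1 | simple apply computable_pi2
    | simple apply computable_pair | simple apply computable_succ
    | simple apply computable_pred | simple apply computable_add
    | simple apply computable_mul | simple apply computable_sub
    | simple apply computable_double | simple apply computable_half
    | simple apply computable_odd | simple apply computable_eq0
    | simple apply computable_eq | simple apply computable_leq
    | simple apply computable_neg | simple apply computable_and
    | simple apply computable_if | simple apply computable_foldl
    | simple apply computable_query ]; cbv beta
  end.

(* The code [sfrac p q d] stands for the fraction [(p - q) / (d + 1)]: with the
   sign split off, the field operations are polynomials in natural numbers. *)
Definition sfrac (p q d : nat) : nat := npair p (npair q d).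
Definition fpos x := pi1 x.
Definition fneg x := pi1 (pi2 x).
Definition fden x := (pi2 (pi2 x)).+1.

Definition fadd x y : nat :=
  sfrac (fpos x * fden y + fpos y * fden x) (fneg x * fden y + fneg y * fden x)
       (fden x * fden y).-1.
Definition fopp x : nat := sfrac (fneg x) (fpos x) (pi2 (pi2 x)).
Definition fsub x y : nat := fadd x (fopp y).
Definition fmul x y : nat :=
  sfrac (fpos x * fpos y + fneg x * fneg y) (fpos x * fneg y + fneg x * fpos y)
       (fden x * fden y).-1.
(** An upper bound of the absolute value, exact when one of the two parts is 0, as for the output of
    [frac_of_rat]. *)
Definition fnorm x : nat := sfrac (fpos x + fneg x) 0 (pi2 (pi2 x)).
Definition flt x y : bool :=
  ((fpos x * fden y + fneg y * fden x) < (fpos y * fden x + fneg x * fden y))%N.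
(** The parity of an integer code is its sign, and [Negz n] is [-(n + 1)], whence the successor. The
    second component of a rational code is already the denominator minus one. *)
Definition frac_of_rat c : nat :=
  let a := pi1 c in
  sfrac (if odd a then 0 else a./2) (if odd a then a./2.+1 else 0) (pi2 c).

Section FracComputable.
Variable V : (nat -> nat) -> Prop.
Local Notation C := (computable V).
Implicit Types f g : (nat -> nat) -> nat -> nat.

Lemma computable_frac_of_rat f : C f -> C (fun O x => frac_of_rat (f O x)).
Proof. by move=> ?; rewrite /frac_of_rat /sfrac; computability. Qed.

Lemma computable_fadd f g : C f -> C g -> C (fun O x => fadd (f O x) (g O x)).
Proof. by move=> ? ?; rewrite /fadd /sfrac /fpos /fneg /fden; computability. Qed.

Lemma computable_fmul f g : C f -> C g -> C (fun O x => fmul (f O x) (g O x)).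
Proof. by move=> ? ?; rewrite /fmul /sfrac /fpos /fneg /fden; computability. Qed.

Lemma computable_fsub f g : C f -> C g -> C (fun O x => fsub (f O x) (g O x)).
Proof.
by move=> ? ?; apply: computable_fadd => //;
   rewrite /fopp /sfrac /fpos /fneg /fden; computability.
Qed.

Lemma computable_fnorm f : C f -> C (fun O x => fnorm (f O x)).
Proof. by move=> ?; rewrite /fnorm /sfrac /fpos /fneg /fden; computability. Qed.

Lemma computable_flt f g : C f -> C g -> C (fun O x => flt (f O x) (g O x)).
Proof. by move=> ? ?; rewrite /flt /fpos /fneg /fden; computability. Qed.

End FracComputable.

Ltac fcomputability :=
  repeat first [ progress computability
    | simple apply computable_frac_of_rat | simple apply computable_fadd
    | simple apply computable_fmul | simple apply computable_fsub
    | simple apply computable_fnorm | simple apply computable_flt].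

(** The even half of the oracle is the name of the presentation of [X]. The test asks for an entry
    [r < d(p_i, p_k) < r'] with [r' < r + 1/(N + 1)]. *)
Definition is_approx (O : nat -> nat) (i k N t : nat) : bool :=
  let e := O t.*2 in
  [&& pi1 (pi2 e) == i, pi1 (pi2 (pi2 e)) == k
    & flt (frac_of_rat (pi2 (pi2 (pi2 e))))
          (fadd (frac_of_rat (pi1 e)) (sfrac 1 0 N))].

(** The upper end [r'] is kept, an overestimate by less than [1/(N + 1)]. It is thus nonnegative, as
    the product estimates require. *)
Definition approx (O : nat -> nat) (i k N : nat) : nat :=
  frac_of_rat (pi2 (pi2 (pi2 (O (least (is_approx O i k N)).*2)))).

(** The parity of a letter marks the involution, which fixes the real-valued generators. Index 0 is
    the unit and index [i + 1] the distance to [p_i]. *)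
Definition letter_approx (O : nat -> nat) (k N l : nat) : nat :=
  if l./2 == 0 then sfrac 1 0 0 else approx O l./2.-1 k N.

(** The pair of [\prod v] and [\prod (v + 2/(N + 1))]. One [1/(N + 1)] pays for the error of
    [approx], the other for moving from [p_k] to a point at distance less than [1/(N + 1)]. *)
Definition word_approx (O : nat -> nat) (k N w : nat) : nat :=
  foldl (fun acc l => npair (fmul (pi1 acc) (letter_approx O k N l))
      (fmul (pi2 acc) (fadd (letter_approx O k N l) (sfrac 2 0 N))))
    (npair (sfrac 1 0 0) (sfrac 1 0 0)) (CodeSeq.decode w).

(** A triple: real part of the center, imaginary part of the center, radius. *)
Definition poly_approx (O : nat -> nat) (k N j : nat) : nat :=
  foldl (fun acc m =>
      npair (fadd (pi1 acc)
        (fmul (frac_of_rat (pi1 (pi1 m))) (pi1 (word_approx O k N (pi2 m)))))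
      (npair (fadd (pi1 (pi2 acc))
        (fmul (frac_of_rat (pi2 (pi1 m))) (pi1 (word_approx O k N (pi2 m)))))
      (fadd (pi2 (pi2 acc))
        (fmul (fadd (fnorm (frac_of_rat (pi1 (pi1 m))))
                    (fnorm (frac_of_rat (pi2 (pi1 m)))))
              (fsub (pi2 (word_approx O k N (pi2 m)))
                    (pi1 (word_approx O k N (pi2 m))))))))
    (npair (sfrac 0 0 0) (npair (sfrac 0 0 0) (sfrac 0 0 0))) (CodeSeq.decode j).

Definition sqr_approx z : nat :=
  fadd (fmul (pi1 z) (pi1 z)) (fmul (pi1 (pi2 z)) (pi1 (pi2 z))).

Definition norm_above (O : nat -> nat) (r j k N : nat) : bool :=
  let e := pi2 (pi2 (poly_approx O k N j)) in
  flt (fmul (fadd r e) (fadd r e)) (sqr_approx (poly_approx O k N j)).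

(** Comparing squares avoids roots; the test [flt e r] excludes a negative [r - e], whose square
    says nothing. *)
Definition ball_below (O : nat -> nat) (r j N k : nat) : bool :=
  let e := pi2 (pi2 (poly_approx O k N j)) in
  flt e r && flt (sqr_approx (poly_approx O k N j)) (fmul (fsub r e) (fsub r e)).

Definition norm_below (O : nat -> nat) (r j N : nat) : bool :=
  foldl (fun b k => (b == 1) && ball_below O r j N k : nat) 1
    (CodeSeq.decode (O N.*2.+1)) == 1.

(* The codes of positive rationals are exactly the last components of the
   elements of the diagram of a presentation of [X] (those of [d(p_0, p_0)]
   yield all of them), so reading them off the given name of [X] guarantees
   that only codes of rationals in lowest terms are produced. *)
Definition name_last (O : nat -> nat) (t : nat) : nat := pi2 (pi2 (pi2 (O t.*2))).

(** A number [n] packs [(a, (b, (j, (k, (N, M)))))]: positions [a] and [b] in the name that supply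
    the two bounds, the index [j] of the vector, the point [k] and precision [N] for the lower
    bound, and the precision [M] for the upper one. *)
Definition candidate_lower (O : nat -> nat) n := name_last O (pi1 n).
Definition candidate_upper (O : nat -> nat) n := name_last O (pi1 (pi2 n)).
Definition candidate_index n := pi1 (pi2 (pi2 n)).

Definition candidate (O : nat -> nat) (n : nat) : nat :=
  npair (candidate_lower O n) (npair (candidate_index n) (candidate_upper O n)).

Definition verified (O : nat -> nat) (n : nat) : bool :=
  norm_above O (frac_of_rat (candidate_lower O n)) (candidate_index n)
    (pi1 (pi2 (pi2 (pi2 n)))) (pi1 (pi2 (pi2 (pi2 (pi2 n))))) &&
  norm_below O (frac_of_rat (candidate_upper O n)) (candidate_index n)
    (pi2 (pi2 (pi2 (pi2 (pi2 n))))).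

(** A failed check still has to produce an output; [c0] is a fixed element of the diagram, so the
    range is not spoiled. *)
Definition search (c0 : nat) (O : nat -> nat) (n : nat) : nat :=
  if verified O n then candidate O n else c0.

(** The halting condition of the search inside [approx], the only unbounded one. *)
Definition approximable (O : nat -> nat) : Prop :=
  forall i k N, exists t, is_approx O i k N t.

Section SearchComputable.
Local Notation C := (computable approximable).
Implicit Types f g h a : (nat -> nat) -> nat -> nat.

Lemma computable_approx f g h : C f -> C g -> C h ->
  C (fun O x => approx O (f O x) (g O x) (h O x)).
Proof.
move=> Cf Cg Ch; rewrite /approx.
have : C (fun O x => least (is_approx O (f O x) (g O x) (h O x))).
  apply: (computable_least
    (p := fun O x => is_approx O (f O x) (g O x) (h O x))) => [? VO ?|].
    exact: VO.
  by rewrite /is_approx /sfrac; fcomputability.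
by move=> ?; fcomputability.
Qed.

Lemma computable_word_approx f g h : C f -> C g -> C h ->
  C (fun O x => word_approx O (f O x) (g O x) (h O x)).
Proof.
move=> Cf Cg Ch; rewrite /word_approx /letter_approx /sfrac.
by repeat first [progress fcomputability | simple apply computable_approx].
Qed.

Lemma computable_poly_approx f g h : C f -> C g -> C h ->
  C (fun O x => poly_approx O (f O x) (g O x) (h O x)).
Proof.
move=> Cf Cg Ch; rewrite /poly_approx /sfrac.
by repeat first [progress fcomputability | simple apply computable_word_approx].
Qed.

Lemma computable_norm_above f g h a : C f -> C g -> C h -> C a ->
  C (fun O x => norm_above O (f O x) (g O x) (h O x) (a O x)).
Proof.
move=> Cf Cg Ch Ca; rewrite /norm_above /sqr_approx.
by repeat first [progress fcomputability | simple apply computable_poly_approx].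
Qed.

Lemma computable_norm_below f g h : C f -> C g -> C h ->
  C (fun O x => norm_below O (f O x) (g O x) (h O x)).
Proof.
move=> Cf Cg Ch; rewrite /norm_below /ball_below /sqr_approx.
by repeat first [progress fcomputability | simple apply computable_poly_approx].
Qed.

Lemma computable_search c0 : C (search c0).
Proof.
rewrite /search /verified /candidate /candidate_lower /candidate_upper
  /candidate_index /name_last.
by repeat first [progress fcomputability
  | simple apply computable_norm_above | simple apply computable_norm_below].
Qed.

End SearchComputable.

(** * Correctness of the approximations *)

Import numFieldNormedType.Exports.
Local Open Scope classical_set_scope.
Local Open Scope ring_scope.
Local Open Scope complex_scope.

(** * Values of coded fractions *)

Section FracValue.
Variable R : realType.

Definition fval (x : nat) : R := ((fpos x)%:R - (fneg x)%:R) / (fden x)%:R.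

Lemma fden_gt0 x : 0 < (fden x)%:R :> R. Proof. by rewrite ltr0n. Qed.

Lemma fden_neq0 x : (fden x)%:R != 0 :> R. Proof. by rewrite pnatr_eq0. Qed.

Lemma fval_sfrac p q d : fval (sfrac p q d) = (p%:R - q%:R) / d.+1%:R.
Proof. by rewrite /fval /sfrac /fpos /fneg /fden !npairE. Qed.

Lemma fval0 : fval (sfrac 0 0 0) = 0.
Proof. by rewrite fval_sfrac subrr mul0r. Qed.

Lemma fval1 : fval (sfrac 1 0 0) = 1.
Proof. by rewrite fval_sfrac subr0 divr1. Qed.

Lemma fvalD x y : fval (fadd x y) = fval x + fval y.
Proof.
rewrite /fadd fval_sfrac prednK ?muln_gt0 // /fval !(natrD, natrM).
have := fden_neq0 x; have := fden_neq0 y.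
by move: (fden x)%:R (fden y)%:R => a b *; field; apply/andP.
Qed.

Lemma fvalM x y : fval (fmul x y) = fval x * fval y.
Proof.
rewrite /fmul fval_sfrac prednK ?muln_gt0 // /fval !(natrD, natrM).
have := fden_neq0 x; have := fden_neq0 y.
by move: (fden x)%:R (fden y)%:R => a b *; field; apply/andP.
Qed.

Lemma fvalB x y : fval (fsub x y) = fval x - fval y.
Proof.
rewrite /fsub fvalD; congr (_ + _).
by rewrite /fopp fval_sfrac /fval -[in RHS]mulNr opprB.
Qed.

Lemma fval_fnorm x : `|fval x| <= fval (fnorm x).
Proof.
rewrite /fnorm fval_sfrac subr0 /fval natrD normrM normfV.
rewrite [`|(fden x)%:R|]ger0_norm ?ler0n //.
rewrite ler_pM2r ?invr_gt0 ?fden_gt0 //.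
by apply: le_trans (ler_normB _ _) _; rewrite !ger0_norm.
Qed.

Lemma fltE x y : flt x y = (fval x < fval y).
Proof.
rewrite /flt /fval ltr_pdivrMr ?fden_gt0 // mulrAC ltr_pdivlMr ?fden_gt0 //.
by rewrite -(ltr_nat R) !natrD !natrM !mulrBl ltrBlDr addrAC ltrBrDr.
Qed.

Lemma fval_frac_of_rat c : fval (frac_of_rat c) = ratr (rat_decode c).
Proof.
rewrite /frac_of_rat fval_sfrac /rat_decode /pi1 /pi2.
case: (Cantor.of_nat c) => a b; rewrite fmorph_div rmorph_int rmorph_nat.
congr (_ / _); rewrite /int_decode /=; case: (odd a).
  by rewrite NegzE mulrNz sub0r.
by rewrite subr0.
Qed.

Lemma fval_rat_code r : fval (frac_of_rat (rat_code r)) = ratr r.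
Proof. by rewrite fval_frac_of_rat rat_codeK. Qed.

End FracValue.

(** * Discs enclosing the values of a polynomial *)

Section Words.
Variable R : realType.
Implicit Types (s : seq nat) (x v : nat -> R).
Local Notation fval := (fval R).

(* Compared with products of intervals, [\prod v] and [\prod (v + d)] give the
   center and, by their difference, the radius of an enclosing ball. *)
Lemma prod_ball s x v (d : R) :
  (forall l, 0 <= v l) -> (forall l, `|x l - v l| <= d) ->
  [/\ 0 <= \prod_(l <- s) v l, \prod_(l <- s) v l <= \prod_(l <- s) (v l + d)
    & `|\prod_(l <- s) x l - \prod_(l <- s) v l| <=
      \prod_(l <- s) (v l + d) - \prod_(l <- s) v l].
Proof.
move=> v0 xv; elim: s => [|l s [IH0 IH1 IH2]].
  by rewrite !big_nil !subrr normr0; split.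
rewrite !big_cons; move: (v0 l) (xv l).
move: (\prod_(j <- s) v j) (\prod_(j <- s) x j) (\prod_(j <- s) (v j + d))
  (v l) (x l) IH0 IH1 IH2 => a b c w y a0 ac + w0.
rewrite !ler_norml => /andP[b1 b2] /andP[y1 y2].
have d0 : 0 <= d by lra.
have {}bc : `|b| <= c by rewrite ler_norml; apply/andP; split; lra.
have h1 : `|(y - w) * b| <= d * c.
  by rewrite normrM ler_pM // ler_norml y1.
have h2 : `|w * (b - a)| <= w * (c - a).
  by rewrite normrM (ger0_norm w0) ler_wpM2l // ler_norml b1.
split; [exact: mulr_ge0|nra|].
have -> : y * b - w * a = (y - w) * b + w * (b - a) by ring.
have -> : (w + d) * c - w * a = d * c + w * (c - a) by ring.
rewrite -ler_norml; exact: le_trans (ler_normD _ _) (lerD h1 h2).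
Qed.

(** The radius for a word is at most a constant times [d], uniformly in [v]. The induction splits
    the new radius [(w + d) c - w a] into [d c + w (c - a)]. *)
Lemma prod_modulus s v (M d : R) :
  0 <= M -> 0 <= d <= 1 -> (forall l, 0 <= v l <= M) ->
  [/\ 0 <= \prod_(l <- s) v l,
      0 <= \prod_(l <- s) (v l + d) <= (M + 1) ^+ size s
    & \prod_(l <- s) (v l + d) - \prod_(l <- s) v l <= (M + 1) ^+ size s * d].
Proof.
move=> M0 /andP[d0 d1] vM; elim: s => [|l s [IH0 /andP[IH1 IH2] IH3]].
  by rewrite !big_nil subrr mul1r ler01 lexx d0.
rewrite !big_cons /= exprS; have /andP[w0 wM] := vM l.
have : 0 <= (M + 1) ^+ size s by rewrite exprn_ge0 // addr_ge0.
move: (\prod_(j <- s) v j) (\prod_(j <- s) (v j + d)) (v l) ((M + 1) ^+ size s)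
  IH0 IH1 IH2 IH3 w0 wM => a c w K a0 c0 cK acK w0 wM K0.
split; first exact: mulr_ge0.
  by rewrite mulr_ge0 ?ler_pM ?addr_ge0 // lerD.
have -> : (w + d) * c - w * a = d * c + w * (c - a) by ring.
have -> : (M + 1) * K * d = d * K + M * (K * d) by ring.
apply: lerD; first by rewrite ler_wpM2l.
apply: le_trans (ler_wpM2l w0 acK) _.
by rewrite ler_wpM2r ?mulr_ge0.
Qed.

Lemma word_approxE O k N w :
  let W := word_approx O k N w in
  let v l := fval (letter_approx O k N l) in
  fval (pi1 W) = \prod_(l <- CodeSeq.decode w) v l /\
  fval (pi2 W) = \prod_(l <- CodeSeq.decode w) (v l + 2 / N.+1%:R).
Proof.
rewrite /word_approx /=; elim/last_ind: (CodeSeq.decode w) => [|s l [IH1 IH2]].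
  by rewrite /= !npairE !big_nil fval1.
rewrite foldl_rcons !npairE !fvalM fvalD IH1 IH2 fval_sfrac subr0.
by rewrite -!cats1 !big_cat !big_seq1.
Qed.

Definition coef (m : nat) : R * R :=
  (fval (frac_of_rat (pi1 (pi1 m))), fval (frac_of_rat (pi2 (pi1 m)))).

Definition coef_norm (m : nat) : R :=
  fval (fnorm (frac_of_rat (pi1 (pi1 m)))) +
  fval (fnorm (frac_of_rat (pi2 (pi1 m)))).

Lemma coef_norm_ge0 m : 0 <= coef_norm m.
Proof. by apply: addr_ge0; apply: le_trans (fval_fnorm _ _). Qed.

Lemma poly_approxE O k N j :
  let W m := word_approx O k N (pi2 m) in
  let z := poly_approx O k N j in
  [/\ fval (pi1 z) =
        \sum_(m <- CodeSeq.decode j) (coef m).1 * fval (pi1 (W m)),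
      fval (pi1 (pi2 z)) =
        \sum_(m <- CodeSeq.decode j) (coef m).2 * fval (pi1 (W m))
    & fval (pi2 (pi2 z)) = \sum_(m <- CodeSeq.decode j)
        coef_norm m * (fval (pi2 (W m)) - fval (pi1 (W m)))].
Proof.
rewrite /poly_approx /=.
elim/last_ind: (CodeSeq.decode j) => [|s l [IH1 IH2 IH3]].
  by rewrite /= !npairE !big_nil fval0.
rewrite foldl_rcons !npairE !(fvalD, fvalM, fvalB) IH1 IH2 IH3.
by rewrite -!cats1 !big_cat !big_seq1.
Qed.

Definition poly_value (x : nat -> R) (j : nat) : R[i] :=
  \sum_(m <- CodeSeq.decode j)
    ((coef m).1 +i* (coef m).2) * (\prod_(l <- CodeSeq.decode (pi2 m)) x l)%:C.

Definition poly_center O k N j : R[i] :=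
  fval (pi1 (poly_approx O k N j)) +i* fval (pi1 (pi2 (poly_approx O k N j))).

Definition poly_radius O k N j : R := fval (pi2 (pi2 (poly_approx O k N j))).

Lemma poly_centerE O k N j : poly_center O k N j =
  \sum_(m <- CodeSeq.decode j)
    ((coef m).1 +i* (coef m).2) * (fval (pi1 (word_approx O k N (pi2 m))))%:C.
Proof.
have [e1 e2 _] := poly_approxE O k N j; rewrite /poly_center e1 e2.
elim: (CodeSeq.decode j) => [|m s IH]; rewrite ?big_nil // !big_cons -IH.
by simpc.
Qed.

(** Triangle inequality over the monomials: each contributes a bound of its coefficient times the
    radius of its word. *)
Lemma poly_ball O k N j (x : nat -> R) :
  (forall l, 0 <= fval (letter_approx O k N l)) ->
  (forall l, `|x l - fval (letter_approx O k N l)| <= 2 / N.+1%:R) ->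
  Normc.normc (poly_value x j - poly_center O k N j) <= poly_radius O k N j.
Proof.
move=> v0 xv; have [_ _ e3] := poly_approxE O k N j.
rewrite /poly_radius e3 poly_centerE /poly_value.
elim: (CodeSeq.decode j) => [|m s IH].
  by rewrite !big_nil subrr Normc.normc0.
rewrite !big_cons opprD addrACA; apply: le_trans (normcD_le _ _) _.
apply: lerD => //; rewrite -mulrBr Normc.normcM; apply: ler_pM.
- exact: normc_ge0.
- exact: normc_ge0.
- apply: le_trans (normc_le_ReIm _) _.
  by apply: lerD; apply: fval_fnorm.
rewrite -rmorphB normcR; have [e1 e2] := word_approxE O k N (pi2 m).
by rewrite e1 e2; have [_ _] := prod_ball (CodeSeq.decode (pi2 m)) v0 xv.
Qed.

Lemma poly_radius_ge0 O k N j : (forall l, 0 <= fval (letter_approx O k N l)) ->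
  0 <= poly_radius O k N j.
Proof.
(* The disc contains the value taken at the approximations themselves, so its radius bounds some
   norm. *)
move=> v0; apply: le_trans (poly_ball
  (x := fun l => fval (letter_approx O k N l)) j v0 _); first exact: normc_ge0.
by move=> l; rewrite subrr normr0 divr_ge0.
Qed.

(** The constant depends on [j] and [M] alone, so one precision serves all points [p_k]. The
    condition [0 < N] gives [2/(N + 1) <= 1], as [prod_modulus] asks. *)
Lemma poly_radius_le (M : R) j : 0 <= M -> exists2 K : R, 0 <= K &
  forall O k N, (forall l, 0 <= fval (letter_approx O k N l) <= M) ->
  (0 < N)%N -> poly_radius O k N j <= K * (2 / N.+1%:R).
Proof.
move=> M0; exists (\sum_(m <- CodeSeq.decode j)
    coef_norm m * (M + 1) ^+ size (CodeSeq.decode (pi2 m))).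
  apply: sumr_ge0 => m _; apply: mulr_ge0; first exact: coef_norm_ge0.
  by rewrite exprn_ge0 // addr_ge0.
move=> O k N vM N0; have [_ _ e3] := poly_approxE O k N j.
rewrite /poly_radius e3 mulr_suml; apply: ler_sum => m _.
rewrite -mulrA ler_wpM2l ?coef_norm_ge0 //.
have [e1 e2] := word_approxE O k N (pi2 m); rewrite e1 e2.
have d1 : 0 <= (2 / N.+1%:R : R) <= 1.
  by rewrite divr_ge0 //= ler_pdivrMr ?ltr0n // mul1r ler_nat.
by have [_ _] := prod_modulus (CodeSeq.decode (pi2 m)) M0 d1 vM.
Qed.

Lemma sqr_normcE (z : R[i]) :
  Normc.normc z ^+ 2 = complex.Re z ^+ 2 + complex.Im z ^+ 2.
Proof. by case: z => a b /=; rewrite sqr_sqrtr // addr_ge0 ?sqr_ge0. Qed.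

Lemma sqr_approxE O k N j : fval (sqr_approx (poly_approx O k N j)) =
  Normc.normc (poly_center O k N j) ^+ 2.
Proof. by rewrite /sqr_approx fvalD !fvalM sqr_normcE /= !expr2. Qed.

Lemma norm_aboveE O r j k N :
  0 <= fval r -> 0 <= poly_radius O k N j ->
  norm_above O r j k N =
  (fval r + poly_radius O k N j < Normc.normc (poly_center O k N j)).
Proof.
move=> r0 e0; rewrite /norm_above (fltE R) sqr_approxE fvalM fvalD -expr2.
by rewrite ltr_pXn2r // nnegrE ?addr_ge0 ?normc_ge0.
Qed.

Lemma ball_belowE O r j k N :
  0 <= poly_radius O k N j ->
  ball_below O r j N k =
  (Normc.normc (poly_center O k N j) + poly_radius O k N j < fval r).
Proof.
move=> e0; rewrite /ball_below !(fltE R) sqr_approxE fvalM fvalB -expr2.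
rewrite -/(poly_radius O k N j) -(ltrBrDr _ (fval r)).
have c0 := normc_ge0 (poly_center O k N j).
have [er|re] /= := ltP (poly_radius O k N j) (fval r).
  by rewrite ltr_pXn2r // nnegrE ?subr_ge0 ?normc_ge0 // ltW.
by apply/esym/negbTE; rewrite -leNgt; apply: le_trans c0; rewrite subr_le0.
Qed.

Lemma norm_belowE O r j N :
  norm_below O r j N = all (ball_below O r j N) (CodeSeq.decode (O N.*2.+1)).
Proof.
rewrite /norm_below; set s := CodeSeq.decode _; set t := all _ _.
have -> : foldl (fun b k => (b == 1%N) && ball_below O r j N k : nat) 1%N s = t.
  rewrite /t; elim/last_ind: s {t} => //= s k IH.
  rewrite foldl_rcons {}IH all_rcons andbC.
  by case: (all _ s).
by case: t.
Qed.

End Words.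

(** * Correctness of the search *)

Lemma join_double f g n : join f g n.*2 = f n.
Proof. by rewrite /join odd_double doubleK. Qed.

Lemma join_doubleS f g n : join f g n.*2.+1 = g n.
Proof. by rewrite /join oddS odd_double /= uphalf_double. Qed.

Lemma exprVn_le_inv (R : realType) n : (2 : R) ^- n <= 1 / n.+1%:R.
Proof.
rewrite mul1r lef_pV2 ?posrE ?ltr0n ?exprn_gt0 // -natrX ler_nat.
exact: ltn_expl.
Qed.

Lemma inv_natS_lt (R : realType) (C e : R) : 0 < e ->
  exists2 N, (0 < N)%N & C / N.+1%:R < e.
Proof.
move=> e0; have [C0|C0] := leP C 0.
  by exists 1%N => //; apply: le_lt_trans e0; rewrite mulr_le0_ge0 ?invr_ge0.
exists (Num.truncn (C / e)).+1 => //; rewrite ltr_pdivrMr ?ltr0n // mulrC.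
rewrite -ltr_pdivrMr //; apply: lt_trans (truncnS_gt _) _.
by rewrite ltr_nat.
Qed.

(** * Rational vectors as functions on the space *)

Section CfunValue.
Variables (R : realType) (X : compactPolish R).
Implicit Types (h : Cfun X) (x : X).

Lemma cfun_sumE (I : Type) (s : seq I) (h : I -> Cfun X) x :
  (\sum_(i <- s) h i) x = \sum_(i <- s) h i x.
Proof. by elim: s => [|i s IH]; rewrite ?big_nil // !big_cons -IH. Qed.

Lemma cfun_prodE (I : Type) (s : seq I) (h : I -> Cfun X) x :
  (\prod_(i <- s) h i) x = \prod_(i <- s) h i x.
Proof. by elim: s => [|i s IH]; rewrite ?big_nil // !big_cons -IH. Qed.

Variable P : presentation R X.
Local Notation d := (pdist P).
Local Notation p := (ppoint P).

Definition letter_value x (n : nat) : R := if n is m.+1 then d (p m) x else 1.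

Lemma starpoly_evalE (q : starpoly) x :
  starpoly_eval (induced_presentation P) q x =
  \sum_(t <- q) (ratr t.1.1 +i* ratr t.1.2 : R[i]) *
    (\prod_(l <- t.2) letter_value x l.1)%:C.
Proof.
rewrite /starpoly_eval cfun_sumE; apply: eq_bigr => t _.
rewrite -[LHS]/(_ * _); congr (_ * _); rewrite cfun_prodE rmorph_prod.
apply: eq_bigr => -[[|m] b] _ /=.
  by case: b => //; rewrite -[LHS]/(1^*) conjc1.
by case: b => //; rewrite -[LHS]/((d (p m) x)%:C^*) conjc_real.
Qed.

Lemma rational_vectorE j x :
  rational_vector (induced_presentation P) j x =
  poly_value (fun l => letter_value x l./2) j.
Proof.
rewrite /rational_vector starpoly_evalE /poly_value /starpoly_enum big_map.
apply: eq_bigr => m _; rewrite /starmonomial_decode /coef !fval_frac_of_rat.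
rewrite /pi1 /pi2; case: (Cantor.of_nat m) => c w /=.
by case: (Cantor.of_nat c) => a b /=; rewrite big_map.
Qed.

End CfunValue.

(** A supremum of values below [r] may equal [r]; finitely many values admit a common bound [c < r],
    which then bounds a supremum strictly. *)
Lemma all_lt_le (R : realType) (I : Type) (s : seq I) (F : I -> R) (r : R) :
  0 < r -> all (fun k => F k < r) s ->
  exists2 c, c < r & all (fun k => F k <= c) s.
Proof.
move=> r0; elim: s => [|k s IH] /=; first by exists 0.
move=> /andP[Fk /IH[c cr H]]; exists (Num.max (F k) c).
  by rewrite gt_max Fk.
rewrite le_max lexx /=; apply: sub_all H => i Fi.
by rewrite le_max Fi orbT.
Qed.

Section Correctness.
Variables (R : realType) (X : compactPolish R) (P : presentation R X).
Variables (f g : nat -> nat).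
Hypotheses (nf : is_name P f) (tg : total_boundedness_function P g).
Local Notation O := (join f g).
Local Notation u := (induced_presentation P).
Local Notation d := (pdist P).
Local Notation p := (ppoint P).
Local Notation pt x := (fun l : nat => letter_value P x l./2).
Local Notation normc := Normc.normc.

Lemma pdist_ge0 x y : 0 <= d x y.
Proof.
have [d0 _ dC dD] := pdist_metric P.
by have := dD x y x; rewrite d0 (dC y x) => ?; lra.
Qed.

Lemma name_elem t : exists r i k r',
  f t = npair (rat_code r) (npair i (npair k (rat_code r'))) /\
  ratr r < d (p i) (p k) < ratr r'.
Proof. by have : range f (f t) by []; rewrite nf. Qed.

Lemma name_mem r i k r' : ratr r < d (p i) (p k) < ratr r' ->
  exists t, f t = npair (rat_code r) (npair i (npair k (rat_code r'))).
Proof.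
move=> rr; have : diagram P (npair (rat_code r) (npair i (npair k (rat_code r')))).
  by exists r, i, k, r'.
by rewrite -nf => -[t _ <-]; exists t.
Qed.

Lemma name_approximable : approximable O.
Proof.
(* Both ends of the interval are chosen within half of [1/(N + 1)] of the distance, so its width is
   below [1/(N + 1)]. *)
move=> i k N; have e0 : 0 < 1 / N.+1%:R / 2 :> R by rewrite !divr_gt0.
set e := _ / _ in e0.
have [|r] := @rat_in_itvoo R (d (p i) (p k) - e) (d (p i) (p k)).
  by rewrite ltrBlDr ltrDl.
have [|r'] := @rat_in_itvoo R (d (p i) (p k)) (d (p i) (p k) + e).
  by rewrite ltrDl.
rewrite !in_itv /= => /andP[r'1 r'2] /andP[r1 r2].
have [|t ft] := @name_mem r i k r'; first by rewrite r2.
exists t; rewrite /is_approx join_double ft !npairE !eqxx /= (fltE R) fvalD.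
rewrite !fval_rat_code fval_sfrac subr0.
have -> : 1 / N.+1%:R = e + e by exact: splitr.
by lra.
Qed.

Lemma approxP i k N :
  d (p i) (p k) < fval R (approx O i k N) < d (p i) (p k) + 1 / N.+1%:R.
Proof.
have /and3P[] := leastP (name_approximable i k N); rewrite /approx.
move: (least _) => t; rewrite join_double (fltE R) fvalD fval_sfrac subr0.
have [r [i' [k' [r' [-> /andP[h1 h2]]]]]] := name_elem t.
rewrite !npairE !fval_rat_code => /eqP ei /eqP ek h3; subst i' k'.
by rewrite h2 (lt_trans h3) ?ltrD2r.
Qed.

Lemma letter_approx_ge0 k N l : 0 <= fval R (letter_approx O k N l).
Proof.
rewrite /letter_approx; case: eqP => _; first by rewrite fval1.
by have /andP[h _] := approxP l./2.-1 k N; apply: le_trans (ltW h); exact: pdist_ge0.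
Qed.

Lemma letter_approx_ball k N x l : d (p k) x < 1 / N.+1%:R ->
  `|pt x l - fval R (letter_approx O k N l)| <= 2 / N.+1%:R.
Proof.
have [_ _ dC dD] := pdist_metric P.
move=> kx; rewrite /letter_approx; case: (l./2) => [|i] /=.
  by rewrite fval1 subrr normr0 divr_ge0.
have /andP[h1 h2] := approxP i k N.
have := dD (p i) (p k) x; have := dD (p i) x (p k); have := dC x (p k).
have -> : 2 / N.+1%:R = 1 / N.+1%:R + 1 / N.+1%:R :> R by rewrite -mulrDl.
move: (1 / N.+1%:R) kx h2 => e kx h2.
by move=> *; rewrite ler_norml; apply/andP; split; lra.
Qed.

(** By compactness the continuous function [d(p_0, .)] is bounded by its norm in [C*(X)]; any
    distance passes through [p_0]. *)
Lemma pdist_bound : exists2 M, 0 <= M & forall x y, d x y <= M.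
Proof.
have [_ _ dC dD] := pdist_metric P.
exists (cfun_norm (dist_fun P (p 0)) + cfun_norm (dist_fun P (p 0))).
  by rewrite addr_ge0 ?cfun_norm_ge0.
move=> x y; apply: le_trans (dD x (p 0) y) _; rewrite (dC x).
have H z : d (p 0) z <= cfun_norm (dist_fun P (p 0)).
  apply: le_trans (cfun_norm_ub (dist_fun P (p 0)) z).
  by rewrite -[dist_fun _ _ _]/((d (p 0) z)%:C) normcR ler_norm.
exact: lerD.
Qed.

Lemma letter_approx_le : exists2 M, 0 <= M &
  forall k N l, fval R (letter_approx O k N l) <= M.
Proof.
have [M M0 HM] := pdist_bound; exists (M + 1); first exact: addr_ge0.
move=> k N l; rewrite /letter_approx; case: eqP => _.
  by rewrite fval1 lerDr.
have /andP[_ h] := approxP l./2.-1 k N; apply: le_trans (ltW h) _.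
apply: lerD; first exact: HM.
by rewrite ler_pdivrMr ?ltr0n // mul1r ler1n.
Qed.

Lemma rational_vector_ball j k N x : d (p k) x < 1 / N.+1%:R ->
  normc (rational_vector u j x - poly_center R O k N j) <= poly_radius R O k N j.
Proof.
move=> kx; rewrite rational_vectorE; apply: poly_ball => l.
  exact: letter_approx_ge0.
exact: letter_approx_ball.
Qed.

Lemma rational_vector_ball0 j k N :
  normc (rational_vector u j (p k) - poly_center R O k N j)
    <= poly_radius R O k N j.
Proof.
by apply: rational_vector_ball; have [-> _ _ _] := pdist_metric P; rewrite divr_gt0.
Qed.

Lemma search_radius_ge0 k N j : 0 <= poly_radius R O k N j.
Proof. exact/poly_radius_ge0/letter_approx_ge0. Qed.

Lemma search_radius_lt j (e : R) : 0 < e ->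
  exists N, forall k, poly_radius R O k N j < e.
Proof.
move=> e0; have [M M0 HM] := letter_approx_le.
have [K K0 HK] := poly_radius_le j M0.
have [N N0 HN] := inv_natS_lt (K * 2) e0; exists N => k.
apply: le_lt_trans HN; rewrite -mulrA; apply: HK => // l.
by rewrite letter_approx_ge0 HM.
Qed.

Lemma norm_above_sound r j k N : 0 <= fval R r ->
  norm_above O r j k N -> fval R r < cnorm (rational_vector u j).
Proof.
move=> r0; rewrite (norm_aboveE r0 (search_radius_ge0 _ _ _)) => h.
apply: lt_le_trans (cfun_norm_ub (rational_vector u j) (p k)).
have := rational_vector_ball0 j k N; rewrite normcB.
have := normcD_le (poly_center R O k N j - rational_vector u j (p k))
  (rational_vector u j (p k)).
by rewrite subrK => *; lra.
Qed.

Lemma norm_below_sound r j N : 0 < fval R r ->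
  norm_below O r j N -> cnorm (rational_vector u j) < fval R r.
Proof.
move=> r0; rewrite norm_belowE join_doubleS => h.
have {h} : all (fun k => normc (poly_center R O k N j) + poly_radius R O k N j
    < fval R r) (CodeSeq.decode (g N)).
  by apply: sub_all h => k; rewrite (ball_belowE _ (search_radius_ge0 _ _ _)).
case/(all_lt_le r0) => c cr /allP h; apply: le_lt_trans cr.
apply: cfun_norm_le => x.
(* Some net point is within [2^-N <= 1/(N + 1)] of [x], so its disc contains the value at [x]. *)
have : [set: X] x by []; rewrite (tg N) => -[k kN /= kx].
apply: le_trans (h k kN).
have := rational_vector_ball j (lt_le_trans kx (exprVn_le_inv R N)).
have := normcD_le (rational_vector u j x - poly_center R O k N j)
  (poly_center R O k N j).
by rewrite subrK => *; lra.
Qed.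

Lemma norm_above_complete r j : 0 <= fval R r ->
  fval R r < cnorm (rational_vector u j) -> exists k N, norm_above O r j k N.
Proof.
move=> r0 /sup_gt [|_ [x _ <-] rx]; first exact: cfun_range_neq0.
(* The points where the modulus exceeds [r] form a nonempty open set, which density makes contain
   some [p_k]. *)
have : open [set y | fval R r < normc (rational_vector u j y)].
  have /continuousP := @cfun_norm_cts R X (rational_vector u j).
  by move=> /(_ [set y | fval R r < y]); apply; exact: open_gt.
move=> /(ppoint_dense P); case; first by exists x.
move=> y [/= ry [k _ pk]]; exists k; rewrite -{y}pk in ry.
(* Half the gap: the center is off by one radius, and the test asks for another one as margin. *)
have [|N HN] := @search_radius_lt j ((normc (rational_vector u j (p k)) - fval R r) / 2).
  by rewrite divr_gt0 // subr_gt0.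
exists N; rewrite (norm_aboveE r0 (search_radius_ge0 _ _ _)).
have := HN k; have := rational_vector_ball0 j k N.
have := normcD_le (rational_vector u j (p k) - poly_center R O k N j)
  (poly_center R O k N j).
by rewrite subrK => *; lra.
Qed.

Lemma norm_below_complete r j :
  cnorm (rational_vector u j) < fval R r -> exists N, norm_below O r j N.
Proof.
rewrite -subr_gt0 => h.
have [|N HN] := @search_radius_lt j ((fval R r - cnorm (rational_vector u j)) / 2).
  exact: divr_gt0.
exists N; rewrite norm_belowE join_doubleS; apply/allP => k _.
rewrite (ball_belowE _ (search_radius_ge0 _ _ _)).
have := HN k; have := rational_vector_ball0 j k N; rewrite normcB.
have := normcD_le (poly_center R O k N j - rational_vector u j (p k))
  (rational_vector u j (p k)).
have := cfun_norm_ub (rational_vector u j) (p k).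
rewrite subrK; rewrite -/(cnorm _) => *; lra.
Qed.

Lemma name_last_rat t : exists2 r : rat, 0 < r & name_last O t = rat_code r.
Proof.
rewrite /name_last join_double; have [q [i [k [r [-> /andP[_ h]]]]]] := name_elem t.
exists r; last by rewrite !npairE.
by rewrite -(ltr0q R); apply: le_lt_trans h; exact: pdist_ge0.
Qed.

Lemma name_last_surj (r : rat) : 0 < r -> exists t, name_last O t = rat_code r.
Proof.
move=> r0; have [|t ft] := @name_mem (-1) 0 0 r.
  by have [-> _ _ _] := pdist_metric P; rewrite ltrq0 ltr0q r0.
by exists t; rewrite /name_last join_double ft !npairE.
Qed.

Lemma search_is_cname c0 : cdiagram u c0 -> is_cname u (search c0 O).
Proof.
move=> Dc0; rewrite /is_cname /enumerates; apply/seteqP; split.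
  move=> _ [n _ <-]; rewrite /search; case: ifP => // /andP[].
  rewrite /candidate /candidate_lower /candidate_upper.
  have [r r0 ->] := name_last_rat (pi1 n).
  have [r' r'0 ->] := name_last_rat (pi1 (pi2 n)) => above below.
  exists r, (candidate_index n), r'; split=> //.
  rewrite -!(fval_rat_code R) (norm_above_sound _ above); last first.
    by rewrite fval_rat_code ler0q ltW.
  by rewrite (norm_below_sound _ below) // fval_rat_code ltr0q.
move=> _ [r [j [r' [-> r0 r'0 /andP[]]]]].
rewrite -!(fval_rat_code R) => /norm_above_complete [|k [N above]].
  by rewrite fval_rat_code ler0q ltW.
move=> /norm_below_complete [M below].
have [a ea] := name_last_surj r0; have [b eb] := name_last_surj r'0.
(* The witnesses are packed in the order in which [candidate] and [verified] unpack them. *)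
exists (npair a (npair b (npair j (npair k (npair N M))))) => //.
rewrite /search /verified /candidate /candidate_lower /candidate_upper.
by rewrite /candidate_index !npairE ea eb above below.
Qed.

End Correctness.

(** * Density of the rational vectors *)

Section Density.
Variables (R : realType) (X : compactPolish R) (P : presentation R X).
Local Notation u := (induced_presentation P).
Local Notation d := (pdist P).
Local Notation p := (ppoint P).
Local Notation normc := Normc.normc.
Implicit Types (h : X -> R[i]) (k : X -> R) (q : starpoly).

(** Stated for plain functions, so that products, absolute values and minima enter without
    continuity proofs. *)
Definition poly_limit h : Prop := forall e : R, 0 < e ->
  exists q, forall x, normc (starpoly_eval u q x - h x) < e.

Lemma poly_limit_ext h1 h2 : h1 =1 h2 -> poly_limit h1 -> poly_limit h2.
Proof. by move=> h12 H e /H[q Hq]; exists q => x; rewrite -h12. Qed.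

Lemma poly_limit_closed h :
  (forall e : R, 0 < e -> exists2 h', poly_limit h' &
     forall x, normc (h' x - h x) < e) -> poly_limit h.
Proof.
move=> H e e0; have e20 : 0 < e / 2 by rewrite divr_gt0.
have [h' /(_ _ e20)[q Hq] Hh'] := H _ e20; exists q => x.
rewrite -(subrKA (h' x)); apply: le_lt_trans (normcD_le _ _) _.
by rewrite [ltRHS]splitr ltrD.
Qed.

Lemma poly_limitD h1 h2 : poly_limit h1 -> poly_limit h2 ->
  poly_limit (fun x => h1 x + h2 x).
Proof.
move=> H1 H2 e e0; have e20 : 0 < e / 2 by rewrite divr_gt0.
have [q1 Hq1] := H1 _ e20; have [q2 Hq2] := H2 _ e20; exists (q1 ++ q2) => x.
have -> : starpoly_eval u (q1 ++ q2) = starpoly_eval u q1 + starpoly_eval u q2.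
  by rewrite /starpoly_eval big_cat.
rewrite -[X in X - _]/(starpoly_eval u q1 x + starpoly_eval u q2 x) opprD addrACA.
by apply: le_lt_trans (normcD_le _ _) _; rewrite [ltRHS]splitr ltrD.
Qed.

Definition monomial_mul (s t : starmonomial) : starmonomial :=
  ((s.1.1 * t.1.1 - s.1.2 * t.1.2, s.1.1 * t.1.2 + s.1.2 * t.1.1), s.2 ++ t.2).

Lemma starpoly_eval_mul q1 q2 x :
  starpoly_eval u [seq monomial_mul s t | s <- q1, t <- q2] x =
  starpoly_eval u q1 x * starpoly_eval u q2 x.
Proof.
rewrite !starpoly_evalE big_allpairs_dep mulr_suml; apply: eq_bigr => s _.
rewrite mulr_sumr; apply: eq_bigr => t _ /=.
rewrite big_cat rmorphM /= mulrACA; congr (_ * _).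
by rewrite rmorphB rmorphD !rmorphM /=; simpc.
Qed.

Lemma poly_limit_bounded h : poly_limit h ->
  exists2 M : R, 0 < M & forall x, normc (h x) <= M.
Proof.
move=> /(_ 1 ltr01)[q Hq]; exists (cfun_norm (starpoly_eval u q) + 1).
  by rewrite ltr_wpDl // cfun_norm_ge0.
move=> x; rewrite -(subrK (starpoly_eval u q x) (h x)) addrC.
apply: le_trans (normcD_le _ _) _; apply: lerD; first exact: cfun_norm_ub.
by rewrite normcB ltW.
Qed.

Lemma poly_limitM h1 h2 : poly_limit h1 -> poly_limit h2 ->
  poly_limit (fun x => h1 x * h2 x).
Proof.
move=> H1 H2 e e0.
have [M1 M1_0 B1] := poly_limit_bounded H1.
have [M2 M2_0 B2] := poly_limit_bounded H2.
have e1 : 0 < e / 2 / (M2 + 1) by rewrite !divr_gt0 // addr_gt0.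
(* The bound 1 on the second error keeps [z2] below [M2 + 1], by which the first error was
   divided. *)
have e2 : 0 < Num.min 1 (e / 2 / M1) by rewrite lt_min ltr01 !divr_gt0.
have [q1 Hq1] := H1 _ e1; have [q2 Hq2] := H2 _ e2.
exists [seq monomial_mul s t | s <- q1, t <- q2] => x; rewrite starpoly_eval_mul.
have {Hq1}a1 := Hq1 x; have := Hq2 x; rewrite lt_min => /andP[a2 a3].
move: (starpoly_eval u q1 x) (starpoly_eval u q2 x) a1 a2 a3 => z1 z2 a1 a2 a3.
have -> : z1 * z2 - h1 x * h2 x = (z1 - h1 x) * z2 + h1 x * (z2 - h2 x) by ring.
apply: le_lt_trans (normcD_le _ _) _; rewrite !Normc.normcM [ltRHS]splitr.
apply: ltr_leD; last first.
  apply: le_trans (ler_pM (normc_ge0 _) (normc_ge0 _) (B1 x) (ltW a3)) _.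
  by rewrite mulrC divfK ?gt_eqF.
have z2M : normc z2 <= M2 + 1.
  rewrite -(subrK (h2 x) z2) addrC; apply: le_trans (normcD_le _ _) _.
  by rewrite lerD ?B2 // ltW.
have M20 : 0 < M2 + 1 by rewrite addr_gt0.
apply: le_lt_trans (ler_wpM2l (normc_ge0 _) z2M) _.
by rewrite -ltr_pdivlMr.
Qed.

Lemma poly_limit_const (c : R[i]) : poly_limit (fun=> c).
Proof.
move=> e e0; case: c => a b; have e20 : 0 < e / 2 by rewrite divr_gt0.
have [|r] := @rat_in_itvoo R (a - e / 2) (a + e / 2); first by lra.
have [|s] := @rat_in_itvoo R (b - e / 2) (b + e / 2); first by lra.
rewrite !in_itv /= => /andP[s1 s2] /andP[r1 r2].
exists [:: ((r, s), [::])] => x; rewrite starpoly_evalE big_seq1 big_nil mulr1.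
apply: le_lt_trans (normc_le_ReIm _) _ => /=; rewrite [ltRHS]splitr.
by apply: ltrD; rewrite ltr_norml; apply/andP; split; lra.
Qed.

Lemma poly_limit_dist n : poly_limit (fun x => (d (p n) x)%:C).
Proof.
(* The index is [n.+1] since generator 0 is the unit. *)
move=> e e0; exists [:: ((1, 0), [:: (n.+1, false)])] => x.
rewrite starpoly_evalE !big_seq1; set z := _ * _.
suff -> : z = (d (p n) x)%:C by rewrite subrr Normc.normc0.
by rewrite /z /= rmorph1 rmorph0 mul1r.
Qed.

(** * Absolute values and minima of real uniform limits *)

Definition real_limit k : Prop := poly_limit (fun x => (k x)%:C).

Lemma real_limit_ext k1 k2 : k1 =1 k2 -> real_limit k1 -> real_limit k2.
Proof. by move=> k12; apply: poly_limit_ext => x; rewrite k12. Qed.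

Lemma real_limitD k1 k2 : real_limit k1 -> real_limit k2 ->
  real_limit (fun x => k1 x + k2 x).
Proof.
move=> H1 H2; apply: poly_limit_ext (poly_limitD H1 H2) => x.
by rewrite rmorphD.
Qed.

Lemma real_limitM k1 k2 : real_limit k1 -> real_limit k2 ->
  real_limit (fun x => k1 x * k2 x).
Proof.
move=> H1 H2; apply: poly_limit_ext (poly_limitM H1 H2) => x.
by rewrite rmorphM.
Qed.

Lemma real_limit_const c : real_limit (fun=> c).
Proof. exact: poly_limit_const. Qed.

Lemma real_limitZ c k : real_limit k -> real_limit (fun x => c * k x).
Proof. exact/real_limitM/real_limit_const. Qed.

Lemma real_limitB k1 k2 : real_limit k1 -> real_limit k2 ->
  real_limit (fun x => k1 x - k2 x).
Proof.
move=> H1 H2; apply: real_limit_ext (real_limitD H1 (real_limitZ (-1) H2)) => x.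
by rewrite mulN1r.
Qed.

Lemma real_limit_closed k :
  (forall e : R, 0 < e -> exists2 k', real_limit k' &
     forall x, `|k' x - k x| < e) -> real_limit k.
Proof.
move=> H; apply: poly_limit_closed => e /H[k' Hk' kk'].
by exists (fun x => (k' x)%:C) => // x; rewrite -rmorphB normcR.
Qed.

(* Polynomials in [y] increasing to [sqrt y], uniformly on [0, 1]. *)
Fixpoint sqrt_iter (n : nat) (y : R) : R :=
  if n is m.+1 then sqrt_iter m y + (y - sqrt_iter m y ^+ 2) / 2 else 0.

(** With [t] the current iterate, the error [D = s - t] becomes [D (1 - (s + t)/2)], at most
    [D (1 - D/2)]. If [D K <= 2], then [2 - D (1 - D/2) (K + 1) = (2 - D K) (1 - D/2) + D^2/2] is
    nonnegative, so the errors decay like [2/(n + 2)]. *)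
Lemma sqrt_iter_bound n (s : R) : 0 <= s <= 1 ->
  0 <= sqrt_iter n (s ^+ 2) <= s /\ (s - sqrt_iter n (s ^+ 2)) * n.+2%:R <= 2.
Proof.
move=> /andP[s0 s1]; elim: n => [|n [/andP[IH0 IHs] IH]].
  by rewrite /= subr0 lexx s0; split=> //; lra.
have K0 : 0 <= n.+2%:R + 1 :> R by rewrite addr_ge0.
rewrite /= -(natr1 n.+2).
move: (sqrt_iter n _) n.+2%:R K0 IH0 IHs IH => t K K0 t0 ts IH.
have e : s - (t + (s ^+ 2 - t ^+ 2) / 2) = (s - t) * (1 - (s + t) / 2) by ring.
have D0 : 0 <= s - t by lra.
split.
  rewrite -(subr_ge0 _ s) e mulr_ge0 //; last by lra.
  by rewrite andbT addr_ge0 // divr_ge0 // subr_ge0 ler_pXn2r ?nnegrE.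
rewrite e.
apply: (@le_trans _ _ ((s - t) * (1 - (s - t) / 2) * (K + 1))).
  by apply: ler_wpM2r => //; apply: ler_wpM2l => //; lra.
rewrite -subr_ge0; have D1 : 0 <= 1 - (s - t) / 2 by lra.
move: (s - t) D0 D1 IH => D D0 D1 IH.
have -> : 2 - D * (1 - D / 2) * (K + 1) =
    (2 - D * K) * (1 - D / 2) + D ^+ 2 / 2 by field.
by rewrite addr_ge0 ?divr_ge0 ?sqr_ge0 // mulr_ge0 // subr_ge0.
Qed.

Lemma real_limit_sqrt_iter n k : real_limit k ->
  real_limit (fun x => sqrt_iter n (k x)).
Proof.
move=> Hk; elim: n => [|n IHn] /=; first exact: real_limit_const.
apply: real_limitD => //.
apply: real_limit_ext (real_limitZ 2^-1
  (real_limitB Hk (real_limitM IHn IHn))) => x.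
by rewrite mulrC expr2.
Qed.

Lemma real_limit_abs_le1 k : (forall x, `|k x| <= 1) ->
  real_limit k -> real_limit (fun x => `|k x|).
Proof.
move=> k1 Hk; apply: real_limit_closed => e e0.
(* [|k|] is the root of [k^2]; the error of the [N]-th iterate is at most [2/(N + 2)], hence below
   [e]. *)
have [N _ HN] := inv_natS_lt 2 e0; exists (fun x => sqrt_iter N (k x ^+ 2)).
  exact/real_limit_sqrt_iter/real_limitM.
move=> x; rewrite -(real_normK (num_real (k x))).
have [|/andP[h1 h2] h3] := @sqrt_iter_bound N `|k x|; first by rewrite normr_ge0 k1.
rewrite distrC [ltLHS]ger0_norm ?subr_ge0 //; apply: le_lt_trans HN.
rewrite ler_pdivlMr ?ltr0n //; apply: le_trans h3.
by rewrite ler_wpM2l ?subr_ge0 // ler_nat.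
Qed.

Lemma real_limit_abs k : real_limit k -> real_limit (fun x => `|k x|).
Proof.
move=> Hk; have [M M0 HM] := poly_limit_bounded Hk.
have H : real_limit (fun x => `|M^-1 * k x|).
  apply: real_limit_abs_le1 (real_limitZ _ Hk) => x.
  rewrite normrM gtr0_norm ?invr_gt0 // mulrC ler_pdivrMr // mul1r.
  by have := HM x; rewrite normcR.
apply: real_limit_ext (real_limitZ M H) => x.
by rewrite normrM gtr0_norm ?invr_gt0 // mulVKf ?gt_eqF.
Qed.

Lemma real_limit_min k1 k2 : real_limit k1 -> real_limit k2 ->
  real_limit (fun x => Num.min (k1 x) (k2 x)).
Proof.
move=> H1 H2.
have H := real_limitB (real_limitD H1 H2) (real_limit_abs (real_limitB H1 H2)).
by apply: real_limit_ext (real_limitZ 2^-1 H) => x; rewrite minr_absE mulrC.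
Qed.

(** A minimum over reals has no neutral element, so [F 0] is the starting value; it satisfies the
    same lower bound as the other terms. *)
Lemma real_limit_bigmin (F : nat -> X -> R) (s : seq nat) :
  (forall i, real_limit (F i)) ->
  real_limit (fun x => \big[Num.min/F 0 x]_(i <- s) F i x).
Proof.
move=> HF; elim: s => [|i s IH].
  by apply: real_limit_ext (HF 0) => x; rewrite big_nil.
by apply: real_limit_ext (real_limit_min (HF i) IH) => x; rewrite big_cons.
Qed.

(** * Uniform continuity and approximation on a finite net *)

Lemma cfun_unif_continuous (a : Cfun X) (e : R) : 0 < e ->
  exists2 r : R, 0 < r & forall x y, d x y < r -> normc (a x - a y) < e.
Proof.
move=> e0; have [d0 _ dC dD] := pdist_metric P.
(* The near-covering form of compactness turns radii valid near each point into one valid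
   everywhere. *)
have /compact_near_coveringP cX := @cp_compact R X.
suff H : forall x, [set: X] x -> \forall x' \near x & r \near (0 : R)^'+,
    forall y, d x' y < r -> normc (a x' - a y) < e.
  have [r [Hr r0]] := filter_ex (filterI (cX _ _ _ _ H) (nbhs_right_gt 0)).
  by exists r => // x y; exact: Hr.
move=> x _.
have e20 : 0 < e / 2 by rewrite divr_gt0.
have /continuousC_P/(_ x _ e20) := @cfun_cts R X a.
move=> /(pdist_compatible P) [t t0 Ht].
(* With both halves below [t / 2], the points [x'] and [y] are both within [t] of [x]. *)
exists ([set y | d x y < t / 2], [set r | r < t / 2]) => /=.
  split; last by apply: nbhs_right_lt; rewrite divr_gt0.
  by apply/(pdist_compatible P); exists (t / 2) => //; rewrite divr_gt0.
move=> [x' r] [/= xx' rt] y x'y.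
have := dD x x' y => xy.
have h1 : normc (a x - a x') < e / 2 by apply: Ht; rewrite /mkset; lra.
have h2 : normc (a x - a y) < e / 2.
  by apply: Ht; rewrite /mkset; lra.
have -> : a x' - a y = (a x' - a x) + (a x - a y) by ring.
apply: le_lt_trans (normcD_le _ _) _; rewrite normcB.
by rewrite [ltRHS]splitr ltrD.
Qed.

Variable g : nat -> nat.
Hypothesis tg : total_boundedness_function P g.

(* McShane's formula over a finite net: [min_k (k (p_i) + L d (p_i, x))] lies
   above [k] up to the modulus of continuity once [L] exceeds the oscillation of
   [k] divided by [r], and is close to [k x] when some [p_i] is close to [x]. *)
Lemma real_limit_unif_continuous k (M : R) : 0 < M -> (forall x, `|k x| <= M) ->
  (forall e : R, 0 < e -> exists2 r : R, 0 < r &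
     forall x y, d x y < r -> `|k x - k y| < e) -> real_limit k.
Proof.
have [d0 _ dC dD] := pdist_metric P.
move=> M0 kM kc; apply: real_limit_closed => e e0.
have e30 : 0 < e / 3 by rewrite divr_gt0.
have [r r0 kr] := kc _ e30; pose L := M / r *+ 2.
have L0 : 0 < L by rewrite mulrn_wgt0 // divr_gt0.
pose F i x := k (p i) + L * d (p i) x.
(* The net is so fine that a nearby [p_i] changes [k] by less than [e / 3] and has
   [L d(p_i, x) < e / 3], so the minimum exceeds [k x] by less than [e]. *)
have [|N _ HN] := @inv_natS_lt R 1 (Num.min r (e / 3 / L)).
  by rewrite lt_min r0 divr_gt0.
exists (fun x => \big[Num.min/F 0 x]_(i <- CodeSeq.decode (g N)) F i x).
  apply: real_limit_bigmin => i; apply: real_limitD; first exact: real_limit_const.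
  exact/real_limitZ/poly_limit_dist.
move=> x; have Fge i : k x - e / 3 <= F i x.
  have [h|h] := ltP (d (p i) x) r.
    have := kr _ _ h; rewrite ltr_norml => /andP[h1 _].
    have : 0 <= L * d (p i) x by rewrite mulr_ge0 ?(pdist_ge0 P) // ltW.
    by rewrite /F; lra.
  have : L * r <= L * d (p i) x by rewrite ler_wpM2l // ltW.
  have -> : L * r = M + M by rewrite /L mulrnAl divfK ?gt_eqF // mulr2n.
  have := kM x; have := kM (p i); rewrite !ler_norml => /andP[a1 a2] /andP[b1 b2].
  by rewrite /F; lra.
have [i iN xi] : exists2 i, i \in CodeSeq.decode (g N) & d (p i) x < 2 ^- N.
  by have : [set: X] x by []; rewrite (tg N) => -[i iN xi]; exists i.
have := lt_trans xi (le_lt_trans (exprVn_le_inv R N) HN).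
rewrite lt_min ltr_pdivlMr // => /andP[/kr].
rewrite ltr_norml => /andP[_ h1] h2.
have Gge : k x - e / 3 <= \big[Num.min/F 0 x]_(i <- CodeSeq.decode (g N)) F i x.
  by elim/big_ind: _ => // a b ha hb; rewrite le_min ha.
have Gle : \big[Num.min/F 0 x]_(i <- CodeSeq.decode (g N)) F i x <= F i x.
  elim: (CodeSeq.decode _) iN => // i' s IH; rewrite big_cons inE ge_min.
  by case/orP=> [/eqP<-|/IH ->]; rewrite ?lexx ?orbT.
rewrite ltr_norml; apply/andP; split; first by lra.
by rewrite /F in Gle; lra.
Qed.

Lemma induced_is_cpresentation : is_cpresentation u.
Proof.
move=> a e e0; suff H : poly_limit a.
  (* Pointwise strict bounds pass to the supremum only as a weak one, hence [e / 2]. *)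
  have [|q Hq] := H (e / 2); first by rewrite divr_gt0.
  have [n en] := starpoly_enum_surj q; exists n.
  apply: (@le_lt_trans _ _ (e / 2)); last by lra.
  apply: cfun_norm_le => x; apply: ltW; rewrite /rational_vector en; exact: Hq.
have M0 : 0 < cfun_norm a + 1 by rewrite ltr_wpDl // cfun_norm_ge0.
(* Minima require real values, so the real and imaginary parts are approximated separately and
   recombined. *)
have H (pr : R[i] -> R) : (forall z w, pr (z - w) = pr z - pr w) ->
    (forall z, `|pr z| <= normc z) -> real_limit (fun x => pr (a x)).
  move=> prB prn; apply: (real_limit_unif_continuous M0) => [x|e' e'0].
    by apply: le_trans (prn _) _; rewrite ler_wpDr // cfun_norm_ub.
  have [r r0 Hr] := cfun_unif_continuous a e'0; exists r => // x y /Hr.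
  by rewrite -prB; apply: le_lt_trans.
have HR := H _ (fun z w => raddfB (@complex.Re R) z w) (@Re_le_normc R).
have HI := H _ (fun z w => raddfB (@complex.Im R) z w) (@Im_le_normc R).
have := poly_limitD HR (poly_limitM (poly_limit_const 'i%C) HI).
by apply: poly_limit_ext => x; rewrite [RHS]complexE.
Qed.

End Density.

(** * The functional and the identity map *)

Lemma computes_fun F O h1 h2 : computes F O h1 -> computes F O h2 -> h1 = h2.
Proof. by move=> H1 H2; apply/funext => n; exact: eval_fun (H1 n) (H2 n). Qed.

(** Vector names refer to the presentation [u] alone and not to a name of it, so the functional may
    return the given vector name unchanged. *)
Lemma computable_map_id (R : realType) (A : cstarAlgType R) (u : nat -> A) :
  computable_map u u id.
Proof. by exists Query => a m am; exists m; split=> // n; exact: EvalQuery. Qed.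

Lemma isometric_isomorphism_id (R : realType) (A : cstarAlgType R) :
  isometric_isomorphism (@id A).
Proof. by split=> //; split=> //; exists id. Qed.

Theorem theorem5p2 (R : realType) :
  exists Phi : functional,
    forall (X : compactPolish R) (P : presentation R X),
      let u := induced_presentation P in
      (forall f g : nat -> nat,
         is_name P f -> total_boundedness_function P g ->
         is_cpresentation u /\
         exists h : nat -> nat, computes Phi (join f g) h /\ is_cname u h) /\
      (forall f1 f2 g1 g2 h1 h2 : nat -> nat,
         is_name P f1 -> is_name P f2 ->
         total_boundedness_function P g1 -> total_boundedness_function P g2 ->
         computes Phi (join f1 g1) h1 -> computes Phi (join f2 g2) h2 ->
         [/\ is_cname u h1, is_cname u h2
           & computably_isometrically_isomorphic_via u u id]).
Proof.
have [j0 ej0] := starpoly_enum_surj [:: ((1, 0), [::])].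
(* The default output: [j0] names the unit, whose norm 1 lies between [1/2] and 2. *)
pose c0 := npair (rat_code 2^-1) (npair j0 (rat_code 2)).
have [Phi HPhi] := computable_search c0; exists Phi => X P u.
have Dc0 : cdiagram u c0.
  exists 2^-1, j0, 2; split=> //.
  have -> : cnorm (rational_vector u j0) = 1.
    rewrite /rational_vector ej0 /starpoly_eval big_seq1 big_nil /=.
    have -> : ratr 1 +i* ratr 0 = 1 :> R[i] by rewrite rmorph1 rmorph0.
    rewrite scale1r; apply/eqP; rewrite eq_le; apply/andP; split.
      apply: cfun_norm_le => x.
      by rewrite -[(1 : Cfun X) x]/((1 : R)%:C) normcR normr1.
    have [x _] := @cp_nonempty R X.
    apply: le_trans (cfun_norm_ub 1 x).
    by rewrite -[(1 : Cfun X) x]/((1 : R)%:C) normcR normr1.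
  by rewrite fmorphV !rmorph_nat; apply/andP; split; lra.
have computes_search f g : is_name P f ->
    computes Phi (join f g) (search c0 (join f g)).
  by move=> nf; apply/HPhi/(name_approximable _ nf).
split=> [f g nf tg|f1 f2 g1 g2 h1 h2 nf1 nf2 tg1 tg2 H1 H2].
  split; first exact: induced_is_cpresentation tg.
  exists (search c0 (join f g)); split; first exact: computes_search.
  exact: search_is_cname.
split.
(* Determinism forces [h1] to be the output of the search. *)
- by rewrite (computes_fun H1 (computes_search _ g1 nf1)); exact: search_is_cname.
- by rewrite (computes_fun H2 (computes_search _ g2 nf2)); exact: search_is_cname.
split; [exact: isometric_isomorphism_id|exact: computable_map_id|].
by exists id; split=> //; exact: computable_map_id.
Qed.
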